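(* Let $\alpha\in(0,4)$ and let $\mu$ be a probability law on $\mathbb{R}$ that is symmetric and regularly varying with index $\alpha$. For each $n\in\mathbb{N}$ let $A=A_n=(a_{ij})_{1\le i,j\le n}\in\mathbb{R}^{n\times n}$ be a random symmetric matrix whose entries $(a_{ij})_{1\le i\le j\le n}$ are i.i.d. with law $\mu$. Let $\theta>0$ be deterministic, for each $n$ let $v_n\in\mathbb{S}^{n-1}$ be a deterministic unit (column) vector in $\mathbb{R}^n$, and set \[P_n(\theta,v_n)=b_n^{-1}A+\theta v_nv_n^T .\] Then, as $n\to\infty$, \[\lambda_1(P_n(\theta,v_n))\Rightarrow \max(\theta,E_\alpha),\] where $E_\alpha>0$ is a random variable with $\mathbb{P}(E_\alpha<x)=\exp(-x^{-\alpha})$ for all $x>0$.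
   Context: $\lambda_1(M)$ denotes the largest eigenvalue of a real symmetric matrix $M$; $\Rightarrow$ denotes convergence in distribution; $\mathbb{S}^{n-1}$ is the Euclidean unit sphere of $\mathbb{R}^n$. The law of $a_{11}$ is symmetric if $a_{11}\overset{d}{=}-a_{11}$. It is regularly varying with index $\alpha$ if \[\lim_{x\to\infty}\frac{\mathbb{P}(|a_{11}|\ge x)}{x^{-\alpha}L(x)}=1\] for some slowly varying $L:(0,\infty)\to(0,\infty)$, i.e. a measurable function with $\lim_{x\to\infty}L(ax)/L(x)=1$ for every $a>0$. The normalization is \[b_n=\inf\{x>0:\ \mathbb{P}(|a_{11}|\ge x)\le 2n^{-2}\}.\] *)

(* Defs.v *)
From HB Require Import structures.
From mathcomp Require Import all_boot all_order all_algebra.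
From mathcomp Require Import all_classical all_reals all_analysis.

Set Implicit Arguments.
Unset Strict Implicit.
Unset Printing Implicit Defensive.

Import Order.TTheory GRing.Theory Num.Theory.
Import numFieldNormedType.Exports.

Local Open Scope classical_set_scope.
Local Open Scope ring_scope.

(* A law on the line is a probability on [measurableTypeR R], i.e. [R] with its
   Borel sigma-algebra. *)

Definition symmetric_law (R : realType)
    (mu : probability (measurableTypeR R) R) : Prop :=
  forall B : set (measurableTypeR R), measurable B ->
    mu [set x | B (- x)] = mu B.

(* Only the values of [L] on ]0, +oo[ matter. *)
Definition slowly_varying (R : realType) (L : R -> R) : Prop :=
  [/\ measurable_fun (`]0, +oo[ : set R) L,
      forall x : R, 0 < x -> 0 < L x &
      forall a : R, 0 < a -> L (a * x) / L x @[x --> +oo] --> (1 : R)].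

Definition abs_tail (R : realType) (mu : probability (measurableTypeR R) R)
    (x : R) : R :=
  fine (mu [set y : R | x <= `|y|]).

Definition regularly_varying (R : realType) (alpha : R)
    (mu : probability (measurableTypeR R) R) : Prop :=
  exists2 L : R -> R, slowly_varying L &
    abs_tail mu x / (x `^ (- alpha) * L x) @[x --> +oo] --> (1 : R).

(* The set is nonempty and bounded below as soon as [0 < n], so that the
   real-valued infimum is the genuine one. *)
Definition normalization (R : realType)
    (mu : probability (measurableTypeR R) R) (n : nat) : R :=
  inf [set x : R | 0 < x /\ abs_tail mu x <= 2 * n%:R ^- 2].

(* The largest eigenvalue, as the supremum of the set of real eigenvalues.  For
   a symmetric matrix of positive size this set is finite and nonempty, so the
   supremum is a maximum. *)
Definition lambda1 (R : realType) (n : nat) (M : 'M[R]_n) : R :=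
  sup [set a : R | eigenvalue M a].

(* The norm [`|v|] of a matrix in the library is the max norm, hence the
   explicit Euclidean norm. *)
Definition unit_sphere (R : realType) (n : nat) : set 'cV[R]_n :=
  [set v | Num.sqrt (\sum_(i < n) v i 0 ^+ 2) = 1].

Definition has_law (R : realType) (d : measure_display) (T : measurableType d)
    (P : probability T R) (X : T -> R)
    (mu : probability (measurableTypeR R) R) : Prop :=
  measurable_fun [set: T] X /\
  forall B : set (measurableTypeR R), measurable B -> P (X @^-1` B) = mu B.

Definition independent_on (R : realType) (d : measure_display)
    (T : measurableType d) (P : probability T R) (I : finType) (D : {set I})
    (X : I -> T -> R) : Prop :=
  forall (J : {set I}) (B : I -> set (measurableTypeR R)),
    J \subset D -> (forall i, measurable (B i)) ->
    P [set w | forall i, i \in J -> B i (X i w)] =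
    (\prod_(i in J) P (X i @^-1` B i))%E.

(* Only the entries on and above the diagonal are independent. *)
Definition iid_symmetric_matrix (R : realType) (d : measure_display)
    (T : measurableType d) (P : probability T R) (n : nat)
    (A : T -> 'M[R]_n) (mu : probability (measurableTypeR R) R) : Prop :=
  [/\ forall w, (A w)^T = A w,
      forall i j : 'I_n, (i <= j)%N -> has_law P (fun w => A w i j) mu &
      independent_on P [set p : 'I_n * 'I_n | (p.1 <= p.2)%N]%SET
        (fun p w => A w p.1 p.2)].

(* The [X n] may live on different probability spaces.  Convergence of the
   distribution functions at the continuity points of the limiting one; the
   measurability of the maps involved is part of the assertion. *)
Definition cvg_in_distribution (R : realType) (d : nat -> measure_display)
    (T : forall n, measurableType (d n)) (P : forall n, probability (T n) R)
    (X : forall n, T n -> R) (d' : measure_display) (T' : measurableType d')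
    (Q : probability T' R) (Y : T' -> R) : Prop :=
  [/\ forall n, measurable_fun [set: T n] (X n),
      measurable_fun [set: T'] Y &
      forall x : R, {for x, continuous (fun t : R => Q [set w | Y w <= t])} ->
        P n [set w | X n w <= x] @[n --> \oo] --> Q [set w | Y w <= x]].

Definition perturbed (R : realType) (mu : probability (measurableTypeR R) R)
    (n : nat) (theta : R) (v : 'cV[R]_n) (A : 'M[R]_n) : 'M[R]_n :=
  (normalization mu n)^-1 *: A + theta *: (v *m v^T).

Definition frechet (R : realType) (d : measure_display) (T : measurableType d)
    (P : probability T R) (alpha : R) (E : T -> R) : Prop :=
  [/\ measurable_fun [set: T] E, forall w, 0 < E w &
      forall x : R, 0 < x ->
        P [set w | E w < x] = (expR (- (x `^ (- alpha))))%:E].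

(* Main.v *)
(* Truncate the entries of [b_n^-1 A] at a level [u / b_n] decaying like a small
   negative power of [n].  The bounded part [S] has norm o(1): since alpha < 4, its
   entries have variance at most [n^(-1-c)], and a trace moment of fixed large
   order is bounded by summing over walks, each new edge of the walk costing a
   variance.  With probability tending to 1 the large part [L] has no diagonal
   entry and at most one entry per row, and [v_n] has o(1) mass on the rows which
   meet [L]; hence [L + theta v v^T] acts almost as a direct sum, with largest
   eigenvalue close to the maximum of theta and of the largest modulus of an
   entry.  That maximum is governed by the number of entries above the diagonal
   exceeding [x b_n], which is zero with probability tending to
   exp (- x^(-alpha)). *)
Require Import Defs.
From HB Require Import structures.
From mathcomp Require Import all_boot all_order all_algebra.
From mathcomp Require Import all_classical all_reals all_analysis.
From mathcomp Require Import measurable_realfun.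
From mathcomp Require Import ring lra.

Set Implicit Arguments.
Unset Strict Implicit.
Unset Printing Implicit Defensive.

Import Order.TTheory GRing.Theory Num.Theory.
Import numFieldNormedType.Exports.

Local Open Scope classical_set_scope.
Local Open Scope ring_scope.

(** * Quadratic forms and the largest eigenvalue *)

(** Two demands on the cut [u] pull apart: it must stay close to [b_n] so that no row holds two
    large entries, yet [u / b_n] must decay fast enough for a moment of fixed order to beat the
    factor [n] of the trace. A slow decay serves both once the order is large. Regular variation is
    exploited through ratios of tails: the ratio at [2 * x] and [x] tends to [h = 2^(-alpha)], so
    along [2 ^+ j * x0] each step multiplies the tail by a factor between [p] and [q], with
    [p < h < q] and [q^2 < p]. If [2 ^+ J * x0] is comparable to [b_n], then [n^2] lies, up to
    constants, between [q^(-J)] and [p^(-J)], and every error becomes geometric in [J]. The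
    condition [alpha < 4] says that [h > 1/16], which leaves room for [1/4 < q < sqrt h]: the
    truncated variance is then at most of order [(4 q)^J], the square of [b_n] at least of order
    [4^J], and [n q^J] tends to 0. The factor 2 in the normalization answers to the roughly
    [n^2 / 2] entries above the diagonal. *)

Lemma discriminant_le (R : realType) (a b c : R) :
  (forall s, 0 <= a + 2 * b * s + c * s ^+ 2) -> b ^+ 2 <= a * c.
Proof.
move=> h.
have a0 : 0 <= a by have := h 0; rewrite mulr0 expr0n /= mulr0 !addr0.
have c0 : 0 <= c.
  (* For [c < 0] this [s] is at least 1, so [c * s ^+ 2 <= c * s = c - a]; the average of the
     polynomial over [s] and [- s] is then at most [c], which is negative. *)
  rewrite leNgt; apply/negP => c0; pose s := 1 + a / - c.
  have s1 : 1 <= s by rewrite lerDl divr_ge0// oppr_ge0 ltW.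
  have h3 : 0 <= a + c * s ^+ 2.
    by have h1 := h s; have h2 := h (- s); rewrite sqrrN mulrN in h2; lra.
  have h4 : c * s ^+ 2 <= c * s.
    by rewrite ler_nM2l// expr2 ler_peMr// (le_trans ler01).
  have h5 : c * s = c - a by rewrite /s; field; rewrite lt_eqF.
  by lra.
have [c1|c1] := eqVneq c 0.
  have [->|b0] := eqVneq b 0; first by rewrite expr0n /= mulr_ge0.
  have := h (- (a + 1) / (2 * b)).
  rewrite c1 mul0r addr0 mulrCA divff ?mulf_neq0// mulr1; lra.
have cp : 0 < c by rewrite lt_neqAle eq_sym c1.
have := h (- b / c).
have -> : a + 2 * b * (- b / c) + c * (- b / c) ^+ 2 = (a * c - b ^+ 2) / c.
  by field.
by rewrite pmulr_lge0 ?invr_gt0// subr_ge0.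
Qed.

Lemma cauchy_schwarz_sum (R : realType) (I : finType) (f g : I -> R) :
  (\sum_i f i * g i) ^+ 2 <= (\sum_i f i ^+ 2) * (\sum_i g i ^+ 2).
Proof.
apply: discriminant_le => s.
have -> : \sum_i f i ^+ 2 + 2 * (\sum_i f i * g i) * s +
    (\sum_i g i ^+ 2) * s ^+ 2 = \sum_i (f i + s * g i) ^+ 2.
  rewrite mulr_sumr !mulr_suml -!big_split/=; apply: eq_bigr => i _; ring.
by apply: sumr_ge0 => i _; exact: sqr_ge0.
Qed.

Definition bilin {R : realType} {n} (M : 'M[R]_n) (x y : 'cV[R]_n) : R :=
  (x^T *m M *m y) 0 0.

Definition sqnorm {R : realType} {n} (x : 'cV[R]_n) : R := \sum_i x i 0 ^+ 2.

Section Bilin.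
Context {R : realType} {n : nat}.
Implicit Types (M N : 'M[R]_n) (x y : 'cV[R]_n).

Lemma bilinE M x y : bilin M x y = \sum_i \sum_j x i 0 * M i j * y j 0.
Proof.
rewrite /bilin mxE exchange_big /=; apply: eq_bigr => j _.
by rewrite !mxE mulr_suml; apply: eq_bigr => i _; rewrite !mxE.
Qed.

Lemma bilin1 x : bilin 1%:M x x = sqnorm x.
Proof.
by rewrite /bilin mulmx1 mxE; apply: eq_bigr => i _; rewrite mxE -expr2.
Qed.

Lemma bilinC M x y : M^T = M -> bilin M x y = bilin M y x.
Proof.
move=> sM; rewrite /bilin.
transitivity (((x^T *m M *m y)^T) 0 0); first by rewrite [RHS]mxE.
by rewrite !trmx_mul trmxK sM mulmxA.
Qed.

Lemma bilinDm M N x y : bilin (M + N) x y = bilin M x y + bilin N x y.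
Proof. by rewrite /bilin mulmxDr mulmxDl mxE. Qed.

Lemma bilinZm a M x y : bilin (a *: M) x y = a * bilin M x y.
Proof. by rewrite /bilin -scalemxAr -scalemxAl mxE. Qed.

Lemma bilinDl M x1 x2 y : bilin M (x1 + x2) y = bilin M x1 y + bilin M x2 y.
Proof. by rewrite /bilin linearD /= !mulmxDl mxE. Qed.

Lemma bilinDr M x y1 y2 : bilin M x (y1 + y2) = bilin M x y1 + bilin M x y2.
Proof. by rewrite /bilin !mulmxDr mxE. Qed.

Lemma bilinZl M a x y : bilin M (a *: x) y = a * bilin M x y.
Proof. by rewrite /bilin linearZ /= -!scalemxAl mxE. Qed.

Lemma bilinZr M a x y : bilin M x (a *: y) = a * bilin M x y.
Proof. by rewrite /bilin -!scalemxAr mxE. Qed.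

Lemma bilin_rank1 (v x : 'cV[R]_n) :
  bilin (v *m v^T) x x = (\sum_i v i 0 * x i 0) ^+ 2.
Proof.
rewrite bilinE expr2 mulr_suml; apply: eq_bigr => i _.
rewrite mulr_sumr; apply: eq_bigr => j _.
rewrite mxE big_ord1 mxE; ring.
Qed.

Lemma sqnorm_ge0 x : 0 <= sqnorm x.
Proof. by apply: sumr_ge0 => i _; exact: sqr_ge0. Qed.

Lemma sqnormZ a x : sqnorm (a *: x) = a ^+ 2 * sqnorm x.
Proof. by rewrite -!bilin1 bilinZl bilinZr mulrA expr2. Qed.

Lemma sqnorm_eq0 x : sqnorm x = 0 -> x = 0.
Proof.
move=> /eqP; rewrite psumr_eq0; last by move=> i _; exact: sqr_ge0.
move=> /allP x0; apply/colP => i; rewrite mxE; apply/eqP.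
by rewrite -sqrf_eq0; exact: x0 (mem_index_enum _).
Qed.

Lemma sqr_le_sqnorm x i : x i 0 ^+ 2 <= sqnorm x.
Proof.
by rewrite /sqnorm (bigD1 i)//= lerDl sumr_ge0// => j _; exact: sqr_ge0.
Qed.

Lemma psd_cauchy_schwarz M x y : M^T = M -> (forall z, 0 <= bilin M z z) ->
  bilin M x y ^+ 2 <= bilin M x x * bilin M y y.
Proof.
move=> sM M0; apply: discriminant_le => s.
have -> : bilin M x x + 2 * bilin M x y * s + bilin M y y * s ^+ 2 =
    bilin M (x + s *: y) (x + s *: y).
  rewrite bilinDl !bilinDr !bilinZl !bilinZr (bilinC y x sM); ring.
exact: M0.
Qed.

Lemma bilin_bound M x : `|bilin M x x| <= (\sum_i \sum_j `|M i j|) * sqnorm x.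
Proof.
rewrite bilinE mulr_suml; apply: le_trans (ler_norm_sum _ _ _) _.
apply: ler_sum => i _; rewrite mulr_suml; apply: le_trans (ler_norm_sum _ _ _) _.
apply: ler_sum => j _; rewrite 2!normrM.
rewrite (mulrC `|x i 0|) -mulrA ler_wpM2l//.
have h1 := sqr_le_sqnorm x i; have h2 := sqr_le_sqnorm x j.
rewrite -(real_normK (num_real (x i 0))) in h1.
rewrite -(real_normK (num_real (x j 0))) in h2.
have := sqr_ge0 (`|x i 0| - `|x j 0|); nra.
Qed.

(** The Cauchy-Schwarz inequality of the form [M], at [x] and [M^-1 x], reads
    [|x|^4 <= (x^T M x) (x^T M^-1 x)], and the last factor is at most a constant times [|x|^2]. *)
Lemma psd_unitmx_coercive M : M^T = M -> (forall x, 0 <= bilin M x x) ->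
  M \in unitmx -> exists2 C, 0 < C & forall x, sqnorm x <= C * bilin M x x.
Proof.
move=> sM M0 uM; set K := \sum_i \sum_j `|(invmx M) i j|.
exists (K + 1).
  by apply: ltr_wpDl => //; apply: sumr_ge0 => i _; apply: sumr_ge0.
move=> x; have [->|x0] := eqVneq (sqnorm x) 0.
  rewrite mulr_ge0// addr_ge0//; apply: sumr_ge0 => i _; exact: sumr_ge0.
have xp : 0 < sqnorm x by rewrite lt_neqAle eq_sym x0 sqnorm_ge0.
have := psd_cauchy_schwarz x (invmx M *m x) sM M0.
have -> : bilin M x (invmx M *m x) = sqnorm x.
  by rewrite -bilin1 /bilin !mulmxA mulmxK// mulmx1.
have -> : bilin M (invmx M *m x) (invmx M *m x) = bilin (invmx M) x x.
  rewrite /bilin trmx_mul trmx_inv sM -!mulmxA; congr ((_ *m _) 0 0).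
  by rewrite mulKVmx.
move=> h; have := bilin_bound (invmx M) x; rewrite -/K => /ler_normlW hb.
have : sqnorm x ^+ 2 <= bilin M x x * ((K + 1) * sqnorm x).
  by apply: le_trans h _; rewrite ler_wpM2l//; lra.
by rewrite expr2 mulrA ler_pM2r// mulrC.
Qed.

Lemma eigenvalue_le M a t : (forall x, bilin M x x <= t * sqnorm x) ->
  eigenvalue M a -> a <= t.
Proof.
move=> h /eigenvalueP[v vM v0].
have := h v^T; rewrite /bilin trmxK vM -scalemxAl mxE.
have -> : (v *m v^T) 0 0 = sqnorm v^T.
  by rewrite mxE; apply: eq_bigr => i _; rewrite !mxE -expr2.
rewrite ler_pM2r// lt_neqAle sqnorm_ge0 andbT eq_sym; apply: contra v0 => /eqP.
by move=> /sqnorm_eq0 /(congr1 trmx); rewrite trmxK trmx0 => ->.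
Qed.

End Bilin.

(** Let [t] be the supremum of the form on the unit sphere. If [t - M] were invertible it would be
    coercive, and [t - C^-1] would still bound the form; so [t - M] is singular. The maximum is thus
    obtained without compactness of the sphere. *)
Lemma max_rayleigh_eigenvalue (R : realType) n (M : 'M[R]_n.+1) : M^T = M ->
  exists2 t, eigenvalue M t & forall x, bilin M x x <= t * sqnorm x.
Proof.
move=> sM; pose S : set R := [set bilin M x x | x in [set x | sqnorm x = 1]].
have S0 : S !=set0.
  exists (bilin M (delta_mx 0 0) (delta_mx 0 0)), (delta_mx 0 0) => //=.
  rewrite /sqnorm (bigD1 0)//= big1 ?mxE ?eqxx ?expr1n ?addr0// => i i0.
  by rewrite mxE (negbTE i0) expr0n.
have Sb : has_sup S.
  split => //; exists (\sum_i \sum_j `|M i j|) => _ [x /= x1 <-].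
  by have /ler_normlW := bilin_bound M x; rewrite x1 mulr1.
set t := sup S; have ht x : bilin M x x <= t * sqnorm x.
  have [x0|x0] := eqVneq (sqnorm x) 0.
    by rewrite x0 (sqnorm_eq0 x0) /bilin mulmx0 mxE mulr0.
  have xp : 0 < sqnorm x by rewrite lt_neqAle eq_sym x0 sqnorm_ge0.
  rewrite -ler_pdivrMr//; apply: ub_le_sup; first by case: Sb.
  have sx : (Num.sqrt (sqnorm x))^-1 ^+ 2 = (sqnorm x)^-1.
    by rewrite exprVn sqr_sqrtr// ltW.
  exists ((Num.sqrt (sqnorm x))^-1 *: x) => /=.
    by rewrite sqnormZ sx mulVf.
  by rewrite bilinZl bilinZr mulrA -expr2 sx mulrC.
exists t => //; pose B := t%:M - M.
have BE x : bilin B x x = t * sqnorm x - bilin M x x.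
  by rewrite /B -scaleN1r bilinDm bilinZm -scalemx1 bilinZm bilin1 mulN1r.
have sB : B^T = B by rewrite /B linearB /= tr_scalar_mx sM.
have B0 x : 0 <= bilin B x x by rewrite BE subr_ge0.
have [uB|] := boolP (B \in unitmx).
  have [C C0 hC] := psd_unitmx_coercive sB B0 uB.
  exfalso; suff : t <= t - C^-1.
    by have Ci : 0 < C^-1 by [rewrite invr_gt0|]; lra.
  apply: ge_sup => // _ [x /= x1 <-].
  have := hC x; rewrite x1 BE x1 mulr1 -ler_pdivrMl// mulr1; lra.
rewrite unitmxE unitfE negbK => /det0P[v v0 vB].
apply/eigenvalueP; exists v => //; apply/eqP.
by move: vB; rewrite mulmxBr mul_mx_scalar => /eqP; rewrite subr_eq0 eq_sym.
Qed.

Section Lambda1.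
Context {R : realType} {n : nat} {M : 'M[R]_n.+1}.
Hypothesis sM : M^T = M.

Lemma rayleigh_le_lambda1 x : bilin M x x <= lambda1 M * sqnorm x.
Proof.
have [t et ht] := max_rayleigh_eigenvalue sM.
apply: le_trans (ht x) _; rewrite ler_wpM2r ?sqnorm_ge0//.
by apply: ub_le_sup => //; exists t => a; exact: eigenvalue_le.
Qed.

Lemma lambda1_le t : (forall x, bilin M x x <= t * sqnorm x) -> lambda1 M <= t.
Proof.
move=> h; have [t' et' _] := max_rayleigh_eigenvalue sM.
by apply: ge_sup; [exists t'|move=> a; exact: eigenvalue_le].
Qed.

End Lambda1.

(** * Bounding a quadratic form by the trace of a power *)

Lemma sqr_bilin_le (R : realType) n (S : 'M[R]_n) x : S^T = S -> sqnorm x = 1 ->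
  bilin S x x ^+ 2 <= bilin (S *m S) x x.
Proof.
move=> sS x1.
have -> : bilin (S *m S) x x = sqnorm (S *m x).
  by rewrite -bilin1 /bilin mulmx1 trmx_mul sS !mulmxA.
have -> : bilin S x x = \sum_i x i 0 * (S *m x) i 0.
  by rewrite /bilin -mulmxA mxE; apply: eq_bigr => i _; rewrite mxE.
apply: le_trans (cauchy_schwarz_sum _ _) _.
by rewrite -/(sqnorm x) x1 mul1r.
Qed.

Lemma bilin_sqr_le_trace (R : realType) n (S : 'M[R]_n) x :
  S^T = S -> sqnorm x = 1 -> bilin (S *m S) x x <= \tr (S *m S).
Proof.
move=> sS x1.
have -> : bilin (S *m S) x x = sqnorm (S *m x).
  by rewrite -bilin1 /bilin mulmx1 trmx_mul sS !mulmxA.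
apply: ler_sum => i _; rewrite !mxE.
apply: le_trans (cauchy_schwarz_sum _ _) _.
rewrite -/(sqnorm x) x1 mulr1; apply: ler_sum => j _.
by rewrite -{3}sS mxE -expr2.
Qed.

(** The inequality [(x^T S x)^2 <= x^T S^2 x] for a unit vector is applied to [S], [S^2], [S^4] and
    so on, until the trace of a square, a sum of squares of entries, takes over. Hence the powers of
    two. *)
Lemma bilin_pow_le_trace (R : realType) n (S : 'M[R]_n.+1) m x :
  S^T = S -> sqnorm x = 1 ->
  bilin S x x ^+ (2 ^ m.+1) <= \tr (S ^+ (2 ^ m.+1)).
Proof.
elim: m S => [|m IH] S sS x1.
  rewrite expn1; apply: le_trans (sqr_bilin_le sS x1) _.
  by apply: le_trans (bilin_sqr_le_trace sS x1) _; rewrite expr2.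
rewrite expnS [in leLHS]exprM [in leRHS]exprM.
have sSS : (S ^+ 2)^T = S ^+ 2 by rewrite expr2 trmx_mul sS.
apply: le_trans (IH _ sSS x1); rewrite lerXn2r ?nnegrE ?sqr_ge0//.
  apply: le_trans (sqr_ge0 (bilin S x x)) _.
  by rewrite expr2; exact: sqr_bilin_le.
by rewrite [in leRHS]expr2; exact: sqr_bilin_le.
Qed.

Lemma trace_small_bilin (R : realType) n (S : 'M[R]_n.+1) m (e : R) :
  S^T = S -> 0 <= e -> \tr (S ^+ (2 ^ m.+1)) <= e ^+ (2 ^ m.+1) ->
  forall x, `|bilin S x x| <= e * sqnorm x.
Proof.
move=> sS e0 tS x.
have unit_case y : sqnorm y = 1 -> `|bilin S y y| <= e.
  move=> y1; rewrite -(ler_pXn2r (n := 2 ^ m.+1)) ?expn_gt0// ?nnegrE//.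
  apply: le_trans tS; apply: le_trans (bilin_pow_le_trace m sS y1).
  by rewrite -normrX expnS exprM ger0_norm// exprn_ge0// sqr_ge0.
have [x0|x0] := eqVneq (sqnorm x) 0.
  by rewrite x0 (sqnorm_eq0 x0) /bilin mulmx0 mxE mulr0 normr0.
have xp : 0 < sqnorm x by rewrite lt_neqAle eq_sym x0 sqnorm_ge0.
rewrite -ler_pdivrMr//.
have sx : (Num.sqrt (sqnorm x))^-1 ^+ 2 = (sqnorm x)^-1.
  by rewrite exprVn sqr_sqrtr// ltW.
have := unit_case ((Num.sqrt (sqnorm x))^-1 *: x).
rewrite sqnormZ sx mulVf// => /(_ erefl).
rewrite bilinZl bilinZr mulrA -expr2 sx normrM.
by rewrite (ger0_norm (_ : 0 <= (sqnorm x)^-1)) ?invr_ge0 ?sqnorm_ge0// mulrC.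
Qed.

(** * Testing a form on integer vectors, for the sake of measurability *)

Definition int_vec {R : realType} {n} (z : {ffun 'I_n -> int}) : 'cV[R]_n :=
  \col_i (z i)%:~R.

(** Round [(k + 1) x] down to an integer vector. By homogeneity a negative value of the form at [x]
    contributes a term of order [k^2], while the rounding errors, of coordinates at most 1,
    contribute only order [k]. *)
Lemma bilin_ge0_int (R : realType) n (B : 'M[R]_n) : B^T = B ->
  (forall z : {ffun 'I_n -> int}, 0 <= bilin B (int_vec z) (int_vec z)) ->
  forall x, 0 <= bilin B x x.
Proof.
move=> sB hz x; pose C := \sum_i \sum_j `|B i j|.
have C0 : 0 <= C by apply: sumr_ge0 => i _; exact: sumr_ge0.
have bnd (y z : 'cV[R]_n) (b : R) : 0 <= b -> (forall i, `|y i 0| <= b) ->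
    (forall i, `|z i 0| <= 1) -> `|bilin B y z| <= b * C.
  move=> b0 hy hz'; rewrite bilinE mulr_sumr.
  apply: le_trans (ler_norm_sum _ _ _) _.
  apply: ler_sum => i _; rewrite mulr_sumr; apply: le_trans (ler_norm_sum _ _ _) _.
  apply: ler_sum => j _; rewrite 2!normrM -[leRHS]mulr1.
  by rewrite ler_pM// ?mulr_ge0//; exact: ler_wpM2r.
pose a := \sum_i `|x i 0|.
have a0 : 0 <= a by exact: sumr_ge0.
have xa i : `|x i 0| <= a by rewrite /a (bigD1 i)//= lerDl sumr_ge0.
rewrite leNgt; apply/negP => q0.
have step (k : nat) : - (2 * a * C + C) * k.+1%:R <= bilin B x x * k.+1%:R ^+ 2.
  pose z : {ffun 'I_n -> int} := [ffun i => Num.floor (k.+1%:R * x i 0)].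
  pose y := k.+1%:R *: x - int_vec z.
  have y1 i : `|y i 0| <= 1.
    rewrite !mxE ffunE; have := floor_itv (k.+1%:R * x i 0).
    by move=> /andP[h1 h2]; rewrite intrD in h2; rewrite ger0_norm; lra.
  have -> : bilin B x x * k.+1%:R ^+ 2 =
      bilin B (int_vec z) (int_vec z) + 2 * k.+1%:R * bilin B x y - bilin B y y.
    have -> : int_vec z = k.+1%:R *: x + (-1) *: y :> 'cV[R]_n.
      by rewrite /y scaleN1r opprB addrC subrK.
    clearbody y.
    rewrite bilinDl !bilinDr !bilinZl !bilinZr (bilinC y x sB); ring.
  have h1 := hz z; have := bnd x y a a0 xa y1; have := bnd y y 1 ler01 y1 y1.
  rewrite mul1r => /ler_normlP[_ h2] /ler_normlP[h3 _].
  have k1 : 1 <= k.+1%:R :> R by rewrite ler1n.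
  have : - (bilin B x y) * k.+1%:R <= a * C * k.+1%:R.
    by rewrite ler_wpM2r// (le_trans ler01).
  have : C <= C * k.+1%:R by rewrite ler_peMr.
  nra.
pose k := Num.truncn ((2 * a * C + C) / - bilin B x x).
have := truncnS_gt ((2 * a * C + C) / - bilin B x x).
rewrite -/k ltr_pdivrMr ?oppr_gt0// => hk.
have := step k; rewrite leNgt => /negP; apply.
have kp : 0 < k.+1%:R :> R by rewrite ltr0n.
by rewrite expr2 mulrA ltr_pM2r//; lra.
Qed.

Lemma lambda1_le_int (R : realType) n (M : 'M[R]_n.+1) t : M^T = M ->
  (lambda1 M <= t) <-> (forall z : {ffun 'I_n.+1 -> int},
     bilin M (int_vec z) (int_vec z) <= t * sqnorm (int_vec z)).
Proof.
move=> sM; split=> [Mt z|hz].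
  apply: le_trans (rayleigh_le_lambda1 sM _) _.
  by rewrite ler_wpM2r ?sqnorm_ge0.
apply: lambda1_le => // x; rewrite -subr_ge0.
have E y : t * sqnorm y - bilin M y y = bilin (t%:M - M) y y.
  by rewrite -[- M]scaleN1r bilinDm bilinZm -scalemx1 bilinZm bilin1 mulN1r.
rewrite E; apply: bilin_ge0_int => [|z].
  by rewrite linearB /= tr_scalar_mx sM.
by rewrite -E subr_ge0.
Qed.

(** Use [2 |x_i x_j| <= x_i^2 + x_j^2] in every term; the symmetry of [L] merges the two halves.
    Keeping the weight of each row, instead of one global bound, lets the rows where [L] vanishes
    contribute nothing. *)
Lemma schur_test (R : realType) n (L : 'M[R]_n) x : L^T = L ->
  bilin L x x <= \sum_i x i 0 ^+ 2 * \sum_j `|L i j|.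
Proof.
move=> sL; set r := (X in _ <= X).
have r1 : r = \sum_i \sum_j `|L i j| * x i 0 ^+ 2.
  by apply: eq_bigr => i _; rewrite mulr_sumr; apply: eq_bigr => j _; rewrite mulrC.
have r2 : r = \sum_i \sum_j `|L i j| * x j 0 ^+ 2.
  rewrite r1 exchange_big /=; apply: eq_bigr => i _; apply: eq_bigr => j _.
  by rewrite -[in LHS]sL mxE.
suff : 2 * bilin L x x <= r + r by lra.
rewrite {1}r1 r2 -big_split bilinE mulr_sumr /=; apply: ler_sum => i _.
rewrite -big_split mulr_sumr /=; apply: ler_sum => j _.
rewrite -mulrDr mulrAC mulrCA mulrC mulrA -mulrA.
have := ler_norm (2 * (x i 0 * x j 0) * L i j); rewrite normrM.
move=> h.
have h1 : `|2 * (x i 0 * x j 0)| <= x i 0 ^+ 2 + x j 0 ^+ 2.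
  rewrite ler_norml; have := sqr_ge0 (x i 0 + x j 0).
  have := sqr_ge0 (x i 0 - x j 0); rewrite !expr2 => ? ?; apply/andP; split; lra.
have h2 : `|2 * (x i 0 * x j 0)| * `|L i j| <=
    (x i 0 ^+ 2 + x j 0 ^+ 2) * `|L i j| by exact: ler_wpM2r.
have -> : `|L i j| * (x i 0 ^+ 2 + x j 0 ^+ 2) =
   (x i 0 ^+ 2 + x j 0 ^+ 2) * `|L i j| by rewrite mulrC.
by apply: le_trans h2; apply: le_trans h; rewrite le_eqVlt; apply/orP; left; apply/eqP; ring.
Qed.

(** * A nearly direct sum of [L] and the rank-one term *)

Section Perturbation.
Context {R : realType} {n : nat} (S L : 'M[R]_n.+1) (v : 'cV[R]_n.+1).
Variables (I : pred 'I_n.+1) (theta s e : R).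
Hypotheses (sS : S^T = S) (sL : L^T = L) (v1 : sqnorm v = 1).
Hypotheses (theta0 : 0 <= theta) (s01 : 0 < s <= 1).
Hypothesis (hS : forall x, `|bilin S x x| <= e * sqnorm x).
Hypothesis (hL : forall i j, ~~ I i -> L i j = 0).
Hypothesis (hI : \sum_(i | I i) v i 0 ^+ 2 <= s ^+ 2).

Let sP : (S + L + theta *: (v *m v^T))^T = S + L + theta *: (v *m v^T).
Proof. by rewrite !linearD linearZ /= sS sL trmx_mul trmxK. Qed.

(** Split the mass of [x] into [Y] on [I] and [Z] off [I]. The matrix [L] sees only [Y], the vector
    [v] essentially only [Z], so that the form is nearly [c Y + theta Z]; the overlap of [v] with
    [I] costs [2 * s * theta]. *)
Lemma lambda1_perturbed_le c : (forall i, \sum_j `|L i j| <= c) ->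
  lambda1 (S + L + theta *: (v *m v^T)) <= Num.max theta c + e + 2 * s * theta.
Proof.
move=> hc; apply: lambda1_le => // x.
rewrite !bilinDm bilinZm bilin_rank1.
set Y := \sum_(i | I i) x i 0 ^+ 2; set Z := \sum_(i | ~~ I i) x i 0 ^+ 2.
have YZ : sqnorm x = Y + Z by rewrite /sqnorm (bigID I).
have Y0 : 0 <= Y by apply: sumr_ge0 => i _; exact: sqr_ge0.
have Z0 : 0 <= Z by apply: sumr_ge0 => i _; exact: sqr_ge0.
have hLx : bilin L x x <= c * Y.
  apply: le_trans (schur_test x sL) _; rewrite (bigID I) /=.
  rewrite [X in _ + X]big1 ?addr0; last first.
    by move=> i Ii; rewrite big1 ?mulr0// => j _; rewrite hL ?normr0.
  by rewrite mulr_sumr; apply: ler_sum => i _; rewrite mulrC ler_wpM2r ?sqr_ge0.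
have cs (Q : pred 'I_n.+1) : (\sum_(i | Q i) v i 0 * x i 0) ^+ 2 <=
    (\sum_(i | Q i) v i 0 ^+ 2) * (\sum_(i | Q i) x i 0 ^+ 2).
  have E (g : 'I_n.+1 -> R) : \sum_(i | Q i) g i = \sum_i (Q i)%:R * g i.
    by rewrite big_mkcond; apply: eq_bigr => i _; case: (Q i); rewrite ?mul1r ?mul0r.
  have := cauchy_schwarz_sum (fun i => (Q i)%:R * v i 0) (fun i => (Q i)%:R * x i 0).
  rewrite !E; congr (_ ^+ 2 <= _ * _); apply: eq_bigr => i _;
    by case: (Q i); rewrite ?mul1r ?mul0r// expr0n.
rewrite (bigID I) /=.
have := cs I; have := cs (predC I) => /=.
set a := \sum_(i | I i) _; set b := \sum_(i | ~~ I i) _ => hb ha.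
have [s0 s1] := andP s01.
have hb' : b ^+ 2 <= Z.
  apply: le_trans hb _; rewrite -/Z ler_piMl// -v1 /sqnorm [leRHS](bigID I) /=.
  by rewrite lerDr sumr_ge0// => i _; exact: sqr_ge0.
have ha' : a ^+ 2 <= s ^+ 2 * Y by apply: le_trans ha _; rewrite ler_wpM2r.
(* Since [a] is of order [s], the product is balanced as [a] against [s * b]. *)
have hab : 2 * (a * b) <= s * Y + s * Z.
  have h1 : s * (2 * (a * b)) <= a ^+ 2 + s ^+ 2 * b ^+ 2.
    have := sqr_ge0 (a - s * b); rewrite !expr2; lra.
  have h2 : s ^+ 2 * b ^+ 2 <= s ^+ 2 * Z by rewrite ler_wpM2l ?sqr_ge0.
  by rewrite -(ler_pM2l s0); rewrite !expr2 in ha' h1 h2 *; lra.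
have hv : (a + b) ^+ 2 <= Z + 2 * s * (Y + Z).
  have : s ^+ 2 * Y <= s * Y by rewrite ler_wpM2r// expr2 ler_piMl// ltW.
  rewrite sqrrD; have : 0 <= s * Z by rewrite mulr_ge0// ltW.
  rewrite mulr2n; lra.
have := hS x => /ler_normlP[_ hSx]; rewrite YZ in hSx *.
have h3 : theta * (a + b) ^+ 2 <= theta * (Z + 2 * s * (Y + Z)) by rewrite ler_wpM2l.
have h4 : c * Y <= Num.max theta c * Y by rewrite ler_wpM2r// le_max lexx orbT.
have h5 : theta * Z <= Num.max theta c * Z by rewrite ler_wpM2r// le_max lexx.
have -> : (Num.max theta c + e + 2 * s * theta) * (Y + Z) =
  Num.max theta c * Y + Num.max theta c * Z + e * (Y + Z) + theta * (2 * s * (Y + Z)).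
  by ring.
rewrite mulrDr in h3; lra.
Qed.

(** The test vector is [v] with its coordinates in [I] erased: the form of [L] vanishes there, and
    its squared norm and its inner product with [v] are the same number [Z >= 1 - s^2]. *)
Lemma lambda1_perturbed_ge : s < 1 ->
  theta * (1 - s ^+ 2) - e <= lambda1 (S + L + theta *: (v *m v^T)).
Proof.
move=> s1; have [s0 _] := andP s01.
pose x : 'cV[R]_n.+1 := \col_i (if I i then 0 else v i 0).
pose Z := \sum_(i | ~~ I i) v i 0 ^+ 2.
have xI (F : 'I_n.+1 -> R) : (forall i, I i -> F i = 0) ->
    \sum_i F i = \sum_(i | ~~ I i) F i.
  by move=> F0; rewrite (bigID I) /= big1 ?add0r.
have xZ : sqnorm x = Z.
  rewrite /sqnorm xI => [|i Ii]; last by rewrite mxE Ii expr0n.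
  by apply: eq_bigr => i Ii; rewrite mxE (negbTE Ii).
have Z1 : 1 - s ^+ 2 <= Z.
  by have := v1; rewrite /sqnorm (bigID I) /= -/Z; have := hI; lra.
have Zp : 0 < Z.
  apply: lt_le_trans Z1; rewrite subr_gt0 expr2.
  by rewrite -[X in _ < X]mulr1 ltr_pM// ltW.
have := rayleigh_le_lambda1 sP x; rewrite !bilinDm bilinZm bilin_rank1.
have -> : bilin L x x = 0.
  rewrite bilinE big1// => i _; rewrite big1// => j _.
  have [Ii|Ii] := boolP (I i); first by rewrite mxE Ii !mul0r.
  by rewrite hL// mulr0 mul0r.
have -> : \sum_i v i 0 * x i 0 = Z.
  rewrite xI => [|i Ii]; last by rewrite mxE Ii mulr0.
  by apply: eq_bigr => i Ii; rewrite mxE (negbTE Ii) expr2.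
have := hS x => /ler_normlP[hSx _]; rewrite xZ in hSx * => h.
have : theta * Z - e <= lambda1 (S + L + theta *: (v *m v^T)).
  rewrite -(ler_pM2r Zp) mulrBl -mulrA -expr2; lra.
apply: le_trans; rewrite lerB// ler_wpM2l//.
Qed.

End Perturbation.

Lemma lambda1_entry_ge (R : realType) n (A : 'M[R]_n.+1) (v : 'cV[R]_n.+1)
    (theta d : R) i j : A^T = A -> 0 <= theta -> (forall k, `|A k k| <= d) ->
  i != j -> `|A i j| - d <= lambda1 (A + theta *: (v *m v^T)).
Proof.
move=> sA theta0 hd ij.
have sP : (A + theta *: (v *m v^T))^T = A + theta *: (v *m v^T).
  by rewrite linearD linearZ /= sA trmx_mul trmxK.
pose ei : 'cV[R]_n.+1 := delta_mx i 0; pose ej : 'cV[R]_n.+1 := delta_mx j 0.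
have bE (M : 'M[R]_n.+1) k l : bilin M (delta_mx k 0) (delta_mx l 0) = M k l.
  by rewrite /bilin trmx_delta -rowE -colE !mxE.
have key (s : R) : s ^+ 2 = 1 ->
    s * A i j - d <= lambda1 (A + theta *: (v *m v^T)).
  move=> s1; have := rayleigh_le_lambda1 sP (ei + s *: ej).
  have -> : sqnorm (ei + s *: ej) = 2.
    rewrite -bilin1 bilinDl !bilinDr !bilinZl !bilinZr !bE !mxE !eqxx.
    by rewrite (negbTE ij) eq_sym (negbTE ij) mulrA -expr2 s1 /=; ring.
  rewrite bilinDm bilinZm bilin_rank1 bilinDl !bilinDr !bilinZl !bilinZr !bE.
  have -> : A j i = A i j by rewrite -[in LHS]sA mxE.
  have h1 := sqr_ge0 (\sum_k v k 0 * (ei + s *: ej) k 0).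
  have h2 := mulr_ge0 theta0 h1.
  have /ler_normlP[h3 _] := hd i; have /ler_normlP[h4 _] := hd j.
  rewrite mulrA -expr2 s1; lra.
have [Aij|Aij] := ler0P (A i j); first by rewrite -mulN1r; apply: key; rewrite sqrrN expr1n.
by rewrite -[X in X - _]mul1r; apply: key; rewrite expr1n.
Qed.

(** * Expectation of bounded functions and independence *)

(** A class closed under sums, products and composition with measurable maps, and always integrable
    under a probability, so that linearity of the expectation comes without integrability
    conditions. *)
Definition bounded_measurable {R : realType} {d} {T : measurableType d}
    (f : T -> R) : Prop :=
  measurable_fun [set: T] f /\ exists C : R, forall x, `|f x| <= C.

Section BoundedMeasurable.
Context {R : realType} {d : measure_display} {T : measurableType d}.
Implicit Types f g : T -> R.

Lemma bounded_measurable_cst (c : R) : bounded_measurable (fun _ : T => c).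
Proof. by split; [exact: measurable_cst|exists `|c|]. Qed.

Lemma bounded_measurableD f g : bounded_measurable f -> bounded_measurable g ->
  bounded_measurable (fun x => f x + g x).
Proof.
move=> [mf [C hC]] [mg [D hD]]; split; first exact: measurable_funD.
by exists (C + D) => x; apply: le_trans (ler_normD _ _) _; exact: lerD.
Qed.

Lemma bounded_measurableM f g : bounded_measurable f -> bounded_measurable g ->
  bounded_measurable (fun x => f x * g x).
Proof.
move=> [mf [C hC]] [mg [D hD]]; split; first exact: measurable_funM.
by exists (C * D) => x; rewrite normrM; exact: ler_pM.
Qed.

Lemma bounded_measurableZ c f : bounded_measurable f ->
  bounded_measurable (fun x => c * f x).
Proof. by move=> bf; apply: bounded_measurableM => //; exact: bounded_measurable_cst. Qed.

Lemma bounded_measurableX f n : bounded_measurable f ->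
  bounded_measurable (fun x => f x ^+ n).
Proof.
move=> bf; elim: n => [|n IH].
  by under eq_fun do rewrite expr0; exact: bounded_measurable_cst.
by under eq_fun do rewrite exprS; exact: bounded_measurableM.
Qed.

Lemma bounded_measurable_sum (I : Type) (s : seq I) (Q : pred I) (h : I -> T -> R) :
  (forall i, bounded_measurable (h i)) ->
  bounded_measurable (fun x => \sum_(i <- s | Q i) h i x).
Proof.
move=> bh; elim: s => [|i s IH].
  by under eq_fun do rewrite big_nil; exact: bounded_measurable_cst.
under eq_fun do rewrite big_cons; case: (Q i) => //.
exact: bounded_measurableD.
Qed.

Lemma bounded_measurable_prod (I : eqType) (s : seq I) (h : I -> T -> R) :
  {in s, forall i, bounded_measurable (h i)} ->
  bounded_measurable (fun x => \prod_(i <- s) h i x).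
Proof.
elim: s => [|i s IH] bh.
  by under eq_fun do rewrite big_nil; exact: bounded_measurable_cst.
under eq_fun do rewrite big_cons; apply: bounded_measurableM.
  by apply: bh; rewrite inE eqxx.
by apply: IH => j js; apply: bh; rewrite inE js orbT.
Qed.

Lemma bounded_measurable_indic (A : set T) : measurable A ->
  bounded_measurable (\1_A : T -> R).
Proof.
move=> mA; split; first exact: measurable_indic.
by exists 1 => x; rewrite indicE normr_nat; case: (_ \in _); rewrite ?lexx// ler01.
Qed.

Lemma bounded_measurable_comp d' (T' : measurableType d') (X : T' -> T) f :
  measurable_fun [set: T'] X -> bounded_measurable f ->
  bounded_measurable (fun w => f (X w)).
Proof.
move=> mX [mf [C hC]]; split; first exact: measurableT_comp mf mX.
by exists C.
Qed.

(** Slice the range [[-C, C]] into steps of width [e]: the level sets [B k] are disjoint, so a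
    single term of the sum survives at each point. *)
Lemma simple_approximation f (e : R) : bounded_measurable f -> 0 < e ->
  exists (N : nat) (c : 'I_N -> R) (B : 'I_N -> set T),
    (forall k, measurable (B k)) /\
    forall x, `|f x - \sum_k c k * \1_(B k) x| <= e.
Proof.
move=> [mf [C hC]] e0.
pose N := (Num.truncn ((2 * C) / e)).+1.
pose c (k : 'I_N) := - C + k%:R * e.
pose B (k : 'I_N) := f @^-1` [set` `[c k, c k + e[].
exists N, c, B; split=> [k|x].
  by rewrite -[B k]setTI; apply: mf => //; exact: measurable_itv.
have /andP[x1 x2] : - C <= f x <= C by rewrite -ler_norml.
have x0 : 0 <= (f x + C) / e by rewrite divr_ge0 ?(ltW e0)//; lra.
have /andP[h1 h2] := truncn_itv x0.
rewrite ler_pdivlMr// in h1; rewrite ltr_pdivrMr// in h2.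
have kN : (Num.truncn ((f x + C) / e) < N)%N.
  by rewrite ltnS le_truncn// ler_wpM2r ?invr_ge0 ?(ltW e0)//; lra.
pose k := Ordinal kN.
have hk l : x \in B l = (l == k).
  apply/idP/eqP => [|->].
    rewrite inE /B /= in_itv /= => /andP[l1 l2]; apply: val_inj => /=.
    apply/esym/eqP; rewrite truncn_eq// ler_pdivlMr// ltr_pdivrMr//.
    rewrite /c in l1 l2; apply/andP; split; first lra.
    rewrite -natr1 mulrDl mul1r; lra.
  rewrite inE /B /= in_itv /= /c /=; apply/andP; split; first lra.
  rewrite -natr1 mulrDl mul1r in h2; lra.
rewrite (bigD1 k)//= big1 => [|l lk]; last by rewrite indicE hk (negbTE lk) mulr0.
rewrite indicE hk eqxx mulr1 addr0 /c /= -natr1 mulrDl mul1r in h2 *.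
by rewrite ler_norml; apply/andP; split; lra.
Qed.

End BoundedMeasurable.

Definition Ex {R : realType} {d} {T : measurableType d} (P : probability T R)
  (f : T -> R) : R := \int[P]_w f w.

Section Ex.
Context {R : realType} {d : measure_display} {T : measurableType d}.
Variable P : probability T R.
Implicit Types f g : T -> R.

Lemma bounded_measurable_integrable f : bounded_measurable f ->
  P.-integrable [set: T] (EFin \o f).
Proof.
move=> [mf [C hC]]; apply: measurable_bounded_integrable => //.
  by rewrite -ge0_fin_numE// fin_num_measure.
exists C; split; first exact: num_real.
by move=> M CM x _; apply: le_trans (hC x) (ltW CM).
Qed.

Lemma ExD f g : bounded_measurable f -> bounded_measurable g ->
  Ex P (fun w => f w + g w) = Ex P f + Ex P g.
Proof. by move=> bf bg; rewrite /Ex RintegralD//; exact: bounded_measurable_integrable. Qed.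

Lemma ExZ c f : bounded_measurable f -> Ex P (fun w => c * f w) = c * Ex P f.
Proof. by move=> bf; rewrite /Ex RintegralZl//; exact: bounded_measurable_integrable. Qed.

Lemma Ex_cst c : Ex P (fun=> c) = c.
Proof. by rewrite /Ex Rintegral_cst//= [X in fine X]probability_setT mulr1. Qed.

Lemma Ex_sum (I : Type) (s : seq I) (Q : pred I) (h : I -> T -> R) :
  (forall i, bounded_measurable (h i)) ->
  Ex P (fun w => \sum_(i <- s | Q i) h i w) = \sum_(i <- s | Q i) Ex P (h i).
Proof.
move=> bh; elim: s => [|i s IH].
  by rewrite big_nil -[RHS](Ex_cst 0); congr Ex; apply/funext => w; rewrite big_nil.
rewrite big_cons; transitivity
    (Ex P (fun w => if Q i then h i w + \sum_(j <- s | Q j) h j w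
                    else \sum_(j <- s | Q j) h j w)).
  by congr Ex; apply/funext => w; rewrite big_cons.
case: (Q i) => //; rewrite ExD ?IH//; exact: bounded_measurable_sum.
Qed.

Lemma le_Ex f g : bounded_measurable f -> bounded_measurable g ->
  (forall w, f w <= g w) -> Ex P f <= Ex P g.
Proof.
by move=> bf bg fg; apply: le_Rintegral => //; exact: bounded_measurable_integrable.
Qed.

Lemma Ex_le_cst f c : bounded_measurable f -> (forall w, f w <= c) -> Ex P f <= c.
Proof.
by move=> bf fc; rewrite -[c](Ex_cst); apply: le_Ex => //; exact: bounded_measurable_cst.
Qed.

Lemma Ex_ge0 f : (forall w, 0 <= f w) -> 0 <= Ex P f.
Proof. by move=> f0; exact: Rintegral_ge0. Qed.

Lemma Ex_dist_le f g c : bounded_measurable f -> bounded_measurable g ->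
  (forall w, `|f w - g w| <= c) -> `|Ex P f - Ex P g| <= c.
Proof.
move=> bf bg fg; rewrite ler_distl; apply/andP; split.
  rewrite lerBlDr -[c]Ex_cst -ExD//; last exact: bounded_measurable_cst.
  apply: le_Ex => // [|w].
    by apply: bounded_measurableD => //; exact: bounded_measurable_cst.
  by have := fg w; rewrite ler_distl lerBlDr => /andP[].
rewrite -[X in _ + X]Ex_cst -ExD//; last exact: bounded_measurable_cst.
apply: le_Ex => // [|w].
  by apply: bounded_measurableD => //; exact: bounded_measurable_cst.
by have := fg w; rewrite ler_distl => /andP[].
Qed.

Lemma Ex_indic (A : set T) : measurable A -> Ex P (\1_A) = fine (P A).
Proof.
move=> mA; rewrite /Ex /Rintegral.
by rewrite integral_indic// setIT.
Qed.

End Ex.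

(** Both sides are continuous in [f] for uniform convergence, so indicators suffice. The spectator
    factor [G] will be a product over other indices, which lets independence be propagated one
    factor at a time. *)
Lemma Ex_mul_comp (R : realType) d (T : measurableType d) (P : probability T R)
    d' (T' : measurableType d') (Q : probability T' R) (X : T -> T')
    (G : T -> R) (a : R) :
  measurable_fun [set: T] X -> bounded_measurable G ->
  (forall B, measurable B ->
     Ex P (fun w => G w * \1_B (X w)) = a * fine (Q B)) ->
  forall f, bounded_measurable f -> Ex P (fun w => G w * f (X w)) = a * Ex Q f.
Proof.
move=> mX bG hB f bf; have [_ [C hC]] := bG.
have C0 : 0 <= C by apply: le_trans (hC point).
apply/eqP; rewrite -subr_eq0 -normr_le0; apply/ler_addgt0Pr => e e0.
(* The two approximation errors are [C * (e / D)] and [|a| * (e / D)]; the added 1 keeps [D]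
   positive. *)
rewrite add0r; pose D := C + `|a| + 1.
have D0 : 0 < D by rewrite ltr_wpDl// addr_ge0.
have [N [c [B [mB hf]]]] := simple_approximation bf (divr_gt0 e0 D0).
pose g x := \sum_k c k * \1_(B k) x.
have bB k : bounded_measurable (fun x => c k * \1_(B k) x).
  by apply: bounded_measurableZ; exact: bounded_measurable_indic.
have bg : bounded_measurable g by exact: bounded_measurable_sum.
have hg : Ex P (fun w => G w * g (X w)) = a * Ex Q g.
  transitivity (Ex P (fun w => \sum_k c k * (G w * \1_(B k) (X w)))).
    congr Ex; apply/funext => w; rewrite mulr_sumr; apply: eq_bigr => k _.
    by rewrite mulrCA.
  have bk k : bounded_measurable (fun w => G w * \1_(B k) (X w)).
    apply: bounded_measurableM => //.
    by apply: (bounded_measurable_comp mX); exact: bounded_measurable_indic.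
  rewrite Ex_sum => [|k]; last exact: bounded_measurableZ.
  rewrite Ex_sum// mulr_sumr; apply: eq_bigr => k _.
  rewrite ExZ// ExZ; last exact: bounded_measurable_indic.
  by rewrite hB// Ex_indic// mulrCA.
have -> : Ex P (fun w => G w * f (X w)) - a * Ex Q f =
   (Ex P (fun w => G w * f (X w)) - Ex P (fun w => G w * g (X w)))
   + a * (Ex Q g - Ex Q f) by rewrite hg; ring.
apply: le_trans (ler_normD _ _) _; rewrite normrM.
have h1 : `|Ex Q g - Ex Q f| <= e / D.
  by apply: Ex_dist_le => // x; rewrite distrC.
have h2 : `|Ex P (fun w => G w * f (X w)) - Ex P (fun w => G w * g (X w))| <= C * (e / D).
  apply: Ex_dist_le => [||w].
  - by apply: bounded_measurableM => //; exact: bounded_measurable_comp.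
  - by apply: bounded_measurableM => //; exact: bounded_measurable_comp.
  by rewrite -mulrBr normrM; exact: ler_pM.
have h3 : `|a| * `|Ex Q g - Ex Q f| <= `|a| * (e / D) by exact: ler_wpM2l.
have -> : e = D * (e / D) by rewrite mulrC divfK// gt_eqF.
have : 0 <= e / D by rewrite divr_ge0// ltW.
by move: (e / D) h2 h3 => t h2 h3 t0; rewrite /D; lra.
Qed.

Section Independence.
Context {R : realType} {d : measure_display} {T : measurableType d}.
Context {P : probability T R} {mu : probability (measurableTypeR R) R}.

Lemma Ex_law (X : T -> R) (f : measurableTypeR R -> R) : has_law P X mu ->
  bounded_measurable f -> Ex P (fun w => f (X w)) = Ex mu f.
Proof.
move=> [mX hX] bf; rewrite -[RHS]mul1r.
rewrite -(Ex_mul_comp (P := P) (Q := mu) (X := X) (G := fun=> 1) (a := 1) mX _ _ bf).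
- by congr Ex; apply/funext => w; rewrite mul1r.
- exact: bounded_measurable_cst.
move=> B mB; rewrite mul1r -hX// -Ex_indic; last by rewrite -[X @^-1` _]setTI; exact: mX.
by congr Ex; apply/funext => w; rewrite mul1r.
Qed.

Lemma Ex_prod_indep (I : finType) (D : {set I}) (X : I -> T -> R)
    (f : I -> measurableTypeR R -> R) (s : seq I) :
  independent_on P D X -> (forall i, i \in D -> has_law P (X i) mu) ->
  (forall i, bounded_measurable (f i)) -> uniq s -> {subset s <= D} ->
  Ex P (fun w => \prod_(i <- s) f i (X i w)) = \prod_(i <- s) Ex mu (f i).
Proof.
move=> iX lX bf us sD.
have mpre i (B : set (measurableTypeR R)) : i \in D -> measurable B ->
    measurable (X i @^-1` B).
  by move=> iD mB; have [mX _] := lX _ iD; rewrite -[X i @^-1` _]setTI; exact: mX.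
(* Indices in [s1] already carry a function, those in [s2] still an indicator. With [s1] empty this
   is the definition of independence; an index passes from [s2] to [s1] by [Ex_mul_comp]. *)
suff H s1 s2 (B : I -> set (measurableTypeR R)) : uniq (s1 ++ s2) ->
    {subset s1 ++ s2 <= D} -> (forall i, measurable (B i)) ->
    Ex P (fun w => \prod_(i <- s1) f i (X i w) * \prod_(i <- s2) \1_(B i) (X i w)) =
    \prod_(i <- s1) Ex mu (f i) * \prod_(i <- s2) fine (mu (B i)).
  have := H s [::] (fun=> setT); rewrite cats0 => /(_ us sD (fun=> measurableT)).
  rewrite big_nil mulr1 => <-; congr Ex; apply/funext => w.
  by rewrite big_nil mulr1.
elim: s1 s2 B => [|e s1 IH] s2 B /=.
  move=> us2 s2D mB; rewrite big_nil mul1r.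
  have sub : [set i in s2]%SET \subset D.
    by apply/fintype.subsetP => i; rewrite inE; exact: s2D.
  have := iX [set i in s2]%SET B sub mB => /(congr1 fine).
  rewrite -Ex_indic; last first.
    rewrite (_ : [set w | _] = \big[setI/setT]_(i <- s2) (X i @^-1` B i)).
      rewrite big_seq; apply: big_ind => // [|i /s2D iD]; first exact: measurableI.
      exact: mpre.
    apply/seteqP; split=> w /=.
      move=> h; rewrite -bigcap_seq => i /= is2; apply: h; by rewrite inE.
    by rewrite -bigcap_seq => h i; rewrite inE => is2; exact: h.
  move=> h.
  transitivity (Ex P \1_[set w | forall i, i \in [set i in s2]%SET -> B i (X i w)]).
    congr Ex; apply/funext => w; rewrite big_nil mul1r indicE.
    have [wB|wB] := boolP (w \in _).
      rewrite inE /= in wB; rewrite big_seq big1// => i is2.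
      by rewrite indicE mem_set//; apply: wB; rewrite inE.
    have : ~~ all (fun i => X i w \in B i) s2.
      apply: contra wB => /allP hB; rewrite inE /= => i; rewrite inE => is2.
      by have := hB i is2; rewrite inE.
    rewrite -has_predC => /hasP[i is2 /= iB].
    by rewrite (big_rem i)//= indicE (negbTE iB) mul0r.
  rewrite h; rewrite (eq_bigl (mem s2)); last by move=> i; rewrite inE.
  rewrite -big_uniq//= big_seq [in RHS]big_seq.
  rewrite (eq_bigr (fun i => (fine (mu (B i)))%:E)); last first.
    move=> i is2; have [_ ->//] := lX i (s2D _ is2).
    by rewrite fineK// fin_num_measure.
  by rewrite -(big_morph _ EFinM erefl).
move=> /andP[e12 us12] sD12 mB.
have eD : e \in D by apply: sD12; rewrite inE eqxx.
have s12D : {subset s1 ++ s2 <= D} by move=> i is12; apply: sD12; rewrite inE is12 orbT.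
pose G w := \prod_(i <- s1) f i (X i w) * \prod_(i <- s2) \1_(B i) (X i w).
set a := \prod_(i <- s1) Ex mu (f i) * \prod_(i <- s2) fine (mu (B i)).
have bG : bounded_measurable G.
  apply: bounded_measurableM; apply: bounded_measurable_prod => i is12.
    have /s12D/lX[mX _] : i \in s1 ++ s2 by rewrite mem_cat is12 ?orbT.
    exact: (bounded_measurable_comp mX (bf i)).
  have /s12D/lX[mX _] : i \in s1 ++ s2 by rewrite mem_cat is12 ?orbT.
  exact: (bounded_measurable_comp mX (bounded_measurable_indic (mB i))).
have [mXe lXe] := lX _ eD.
transitivity (Ex P (fun w => G w * f e (X e w))).
  by congr Ex; apply/funext => w; rewrite big_cons /G; ring.
rewrite (Ex_mul_comp (a := a) (Q := mu) mXe bG)//.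
  by rewrite big_cons /a; ring.
(* The induction hypothesis wants a family of sets over all indices; altering [B] at [e] alone
   leaves [s2] untouched. *)
move=> C mC; pose B' i := if i == e then C else B i.
have e2 : e \notin s2 by apply: contra e12; rewrite mem_cat => ->; rewrite orbT.
have B'E : {in s2, B' =1 B}.
  by move=> i is2; rewrite /B'; case: eqP => // ie; move: e2; rewrite -ie is2.
have := IH (e :: s2) B'; rewrite !big_cons.
have -> : B' e = C by rewrite /B' eqxx.
have -> : \prod_(j <- s2) fine (mu (B' j)) = \prod_(j <- s2) fine (mu (B j)).
  by rewrite big_seq [RHS]big_seq; apply: eq_bigr => i is2; rewrite B'E.
move=> /(_ _ _ _)/esym h; rewrite /a -mulrA (mulrC _ (fine _)) h.
- congr Ex; apply/funext => w; rewrite big_cons /G /B' eqxx.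
  rewrite -mulrA; congr (_ * _); rewrite mulrC; congr (_ * _).
  by rewrite big_seq [RHS]big_seq; apply: eq_bigr => i is2; rewrite -/(B' i) B'E.
- by rewrite uniq_catC /= mem_cat orbC -mem_cat e12 uniq_catC.
- by move=> i; rewrite mem_cat inE orbCA -mem_cat -in_cons; exact: sD12.
- by move=> i; rewrite /B'; case: eqP.
Qed.

End Independence.

(** * Trace moments *)

Definition edge {n} (i j : 'I_n) : 'I_n * 'I_n :=
  if (i <= j)%N then (i, j) else (j, i).

Definition upper_triangle n : {set 'I_n * 'I_n} :=
  [set p : 'I_n * 'I_n | (p.1 <= p.2)%N]%SET.

Lemma edge_upper n (i j : 'I_n) : edge i j \in upper_triangle n.
Proof. by rewrite /edge; case: leqP; rewrite inE//= => /ltnW. Qed.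

(** From a given vertex, an edge determines the next one. This bounds the number of steps of a walk
    along edges already seen, and separates two entries of the same row. *)
Lemma edge_injr n (i : 'I_n) : injective (edge i).
Proof.
by move=> j k; rewrite /edge; case: leqP => ?; case: leqP => ? [] *; congruence.
Qed.

Section TraceMoment.
Context {R : realType} {d : measure_display} {T : measurableType d}.
Context {P : probability T R} {mu : probability (measurableTypeR R) R} {n : nat}.
Variables (A : T -> 'M[R]_n.+1).
Hypothesis hA : iid_symmetric_matrix P A mu.

Let X (e : 'I_n.+1 * 'I_n.+1) w := A w e.1 e.2.

Lemma entry_edge w i j : X (edge i j) w = A w i j.
Proof.
rewrite /X /edge; case: leqP => //= _; have [sA _ _] := hA.
by rewrite -[in LHS]sA mxE.
Qed.

Lemma upper_law e : e \in upper_triangle n.+1 -> has_law P (X e) mu.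
Proof. by rewrite inE => he; have [_ + _] := hA; exact. Qed.

Lemma entry_law i j : has_law P (fun w => A w i j) mu.
Proof.
have -> : (fun w => A w i j) = X (edge i j).
  by apply/funext => w; rewrite entry_edge.
exact: upper_law (edge_upper i j).
Qed.

Lemma bounded_measurable_entry (f : measurableTypeR R -> R) i j :
  bounded_measurable f -> bounded_measurable (fun w => f (A w i j)).
Proof. by move=> bf; have [mX _] := entry_law i j; exact: bounded_measurable_comp. Qed.

Variables (g : measurableTypeR R -> R) (M rho : R).
Hypotheses (bg : bounded_measurable g) (gM : forall x, `|g x| <= M).
Hypotheses (g0 : Ex mu g = 0) (g2 : Ex mu (fun x => g x ^+ 2) <= M ^+ 2 * rho).
Hypothesis rho0 : 0 <= rho.

Let M0 : 0 <= M.
Proof. by apply: le_trans (gM 0). Qed.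

(** The first moment vanishes by centering, and from the second on [|g|^c <= M^(c-2) g^2]. There is
    one factor [rho] whatever the multiplicity, so a product over edges pays [rho] once per distinct
    edge. *)
Lemma moment_bound c : (0 < c)%N -> `|Ex mu (fun x => g x ^+ c)| <= M ^+ c * rho.
Proof.
case: c => [//|[_|c _]].
  rewrite (_ : (fun x => _) = g) ?g0 ?normr0 ?mulr_ge0 ?exprn_ge0//.
apply: le_trans (_ : Ex mu (fun x => M ^+ c * g x ^+ 2) <= _); last first.
  rewrite ExZ; last exact: bounded_measurableX.
  by rewrite -[c.+2]addn2 exprD -mulrA ler_wpM2l// exprn_ge0.
rewrite ler_norml -[X in X <= _ <= _]mulN1r -ExZ; last first.
  by apply: bounded_measurableZ; exact: bounded_measurableX.
have b1 : bounded_measurable (fun x => g x ^+ c.+2) by exact: bounded_measurableX.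
have b2 : bounded_measurable (fun x => M ^+ c * g x ^+ 2).
  by apply: bounded_measurableZ; exact: bounded_measurableX.
have key x : `|g x ^+ c.+2| <= M ^+ c * g x ^+ 2.
  rewrite -[c.+2]addn2 exprD normrM (ger0_norm (sqr_ge0 _)) ler_wpM2r ?sqr_ge0//.
  by rewrite normrX lerXn2r// nnegrE.
apply/andP; split; first apply: le_Ex => // [|x].
- exact: bounded_measurableZ.
- by rewrite mulN1r; have := key x; rewrite ler_norml => /andP[].
by apply: le_Ex => // x; have := key x; rewrite ler_norml => /andP[].
Qed.

Lemma edge_product_bound (h : seq ('I_n.+1 * 'I_n.+1)) :
  {subset h <= upper_triangle n.+1} ->
  `|Ex P (fun w => \prod_(e <- h) g (X e w))| <=
    M ^+ size h * rho ^+ size (undup h).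
Proof.
move=> hD; have [_ _ iA] := hA.
have prod_undup (F : 'I_n.+1 * 'I_n.+1 -> R) :
    \prod_(e <- h) F e = \prod_(e <- undup h) F e ^+ count_mem e h.
  by rewrite -big_undup_iterop_count; apply: eq_bigr.
under [fun w => _]eq_fun do rewrite prod_undup.
have := Ex_prod_indep (f := fun e x => g x ^+ count_mem e h) iA upper_law.
move=> /(_ (undup h)) ->; first last.
- by move=> e; rewrite mem_undup; exact: hD.
- exact: undup_uniq.
- by move=> e; exact: bounded_measurableX.
have -> : M ^+ size h = \prod_(e <- h) M by rewrite big_const_seq count_predT iter_mulr_1.
have -> : rho ^+ size (undup h) = \prod_(e <- undup h) rho.
  by rewrite big_const_seq count_predT iter_mulr_1.
rewrite prod_undup -big_split normr_prod /= big_seq [leRHS]big_seq.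
apply: ler_prod => e; rewrite mem_undup => eh; rewrite normr_ge0 /=.
by apply: moment_bound; rewrite -has_count has_pred1.
Qed.

Let S w : 'M[R]_n.+1 := map_mx g (A w).

Lemma bounded_measurable_pow m i j : bounded_measurable (fun w => (S w ^+ m) i j).
Proof.
elim: m i j => [|m IH] i j.
  under eq_fun do rewrite expr0; exact: bounded_measurable_cst.
under eq_fun do rewrite exprS -mulmxE mxE.
apply: bounded_measurable_sum => k; apply: bounded_measurableM => //.
by under eq_fun do rewrite mxE; exact: bounded_measurable_entry.
Qed.

(* [h] is the list of edges already walked: a step along one of its edges has at
   most [size h] possible endpoints, while a step along a new edge costs [rho]. *)
Lemma walk_moment m (h : seq ('I_n.+1 * 'I_n.+1)) i j :
  {subset h <= upper_triangle n.+1} ->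
  Ex P (fun w => \prod_(e <- h) g (X e w) * (S w ^+ m) i j) <=
  M ^+ (size h + m) * rho ^+ size (undup h) *
    (n.+1%:R * rho + (size h + m)%:R) ^+ m.
Proof.
elim: m h i j => [|m IH] h i j hD.
  under [fun w => _]eq_fun do rewrite expr0 mxE mulrC.
  rewrite addn0 expr0 mulr1 ExZ.
    have := edge_product_bound hD; case: (i == j); rewrite ?mul1r ?mul0r.
      by move=> /ler_normlP[].
    by move=> _; rewrite mulr_ge0// exprn_ge0.
  apply: bounded_measurable_prod => e he; have [mX _] := upper_law (hD _ he).
  exact: bounded_measurable_comp mX bg.
have -> : (fun w => \prod_(e <- h) g (X e w) * (S w ^+ m.+1) i j) =
   (fun w => \sum_l \prod_(e <- edge i l :: h) g (X e w) * (S w ^+ m) l j).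
  apply/funext => w; rewrite exprS -mulmxE mxE mulr_sumr; apply: eq_bigr => l _.
  by rewrite big_cons entry_edge mxE; ring.
have hD' l : {subset edge i l :: h <= upper_triangle n.+1}.
  by move=> e; rewrite inE => /orP[/eqP->|/hD//]; exact: edge_upper.
rewrite Ex_sum => [|l]; last first.
  apply: bounded_measurableM (bounded_measurable_pow _ _ _).
  apply: bounded_measurable_prod => e he; have [mX _] := upper_law (hD' l _ he).
  exact: bounded_measurable_comp mX bg.
set Q := (_ + _ : R); set e := size (undup h).
have Q0 : 0 <= Q by rewrite addr_ge0// mulr_ge0.
(* A step along a known edge has weight 1, along a new one weight [rho]. Summed over [l], the known
   edges give at most [size h] and the new ones at most [n.+1%:R * rho], together at most [Q]. *)
apply: le_trans (_ : \sum_l M ^+ (size h + m.+1) * rho ^+ e * Q ^+ m *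
    (if edge i l \in h then 1 else rho) <= _).
  apply: ler_sum => l _; apply: le_trans (IH _ l j (hD' l)) _ => /=.
  (* History and remaining length enter the bound only through their sum, so [Q] does not change
     along the walk. *)
  rewrite addSnnS -/Q; case: ifP => _ /=; first by rewrite mulr1.
  by rewrite exprS le_eqVlt; apply/orP; left; apply/eqP; rewrite /e; ring.
rewrite -mulr_sumr exprS -!mulrA ler_wpM2l ?exprn_ge0// ler_wpM2l ?exprn_ge0//.
rewrite mulrC ler_wpM2r ?exprn_ge0// (bigID (fun l => edge i l \in h)) /= addrC.
rewrite /Q lerD//.
  apply: le_trans (_ : \sum_(l < n.+1) rho <= _).
    rewrite [leRHS](bigID (fun l => edge i l \notin h)) /=.
    rewrite (eq_bigr (fun=> rho)) ?lerDl ?sumr_ge0// => l /negbTE-> //.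
  by rewrite sumr_const card_ord mulr_natl.
rewrite (eq_bigr (fun=> 1)) => [|l ->//].
rewrite sumr_const ler_nat.
have : (size (map (edge i) (enum (fun l => edge i l \in h))) <= size h)%N.
  apply: uniq_leq_size; first by rewrite map_inj_uniq ?enum_uniq//; exact: edge_injr.
  by move=> _ /mapP[l + ->]; rewrite mem_enum.
rewrite size_map -cardE => hc; apply: leq_trans (leq_addr _ _).
by apply: leq_trans hc; rewrite leq_eqVlt; apply/orP; left; apply/eqP; apply: eq_card.
Qed.

(** The walk starts with no known edge, so each of its [K] steps costs at most [M * (1 + K)]. The
    count is crude, but [K] stays fixed while [n] grows, and a constant depending on [K] is
    harmless. *)
Lemma trace_moment K : n.+1%:R * rho <= 1 ->
  Ex P (fun w => \tr (S w ^+ K)) <= n.+1%:R * (M * K.+1%:R) ^+ K.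
Proof.
move=> hrho; rewrite Ex_sum => [|i]; last exact: bounded_measurable_pow.
rewrite mulr_natl -[in leRHS](card_ord n.+1) -sumr_const; apply: ler_sum => i _.
have := walk_moment K (h := [::]) i i; rewrite /= expr0 mulr1 add0n => /(_ _).
under [fun w => _]eq_fun do rewrite big_nil mul1r.
move=> h; apply: le_trans (h _) _ => //.
rewrite exprMn ler_wpM2l ?exprn_ge0// lerXn2r// ?nnegrE ?addr_ge0 ?mulr_ge0//.
by rewrite -[K.+1%:R]natr1 addrC lerD.
Qed.

End TraceMoment.

(** * Regularly varying tails *)

Lemma powR_gt1 (R : realType) (x a : R) : 1 < x -> 0 < a -> 1 < x `^ a.
Proof.
move=> x1 a0; rewrite /powR gt_eqF ?(lt_trans ltr01)//.
by rewrite -expR0 ltr_expR mulr_gt0// ln_gt0.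
Qed.

Section Tail.
Context {R : realType} (mu : probability (measurableTypeR R) R).

Lemma measurable_tail (x : R) : measurable [set y : measurableTypeR R | x <= `|y|].
Proof.
have -> : [set y : measurableTypeR R | x <= `|y|] =
    (@Num.norm R R) @^-1` [set` `[x, +oo[].
  by apply/seteqP; split=> y /=; rewrite in_itv /= andbT.
rewrite -[X in measurable X]setTI.
by apply: (@normr_measurable R setT) => //; exact: measurable_itv.
Qed.

Lemma abs_tail_Ex x : abs_tail mu x = Ex mu \1_[set y : measurableTypeR R | x <= `|y|].
Proof. by rewrite Ex_indic//; exact: measurable_tail. Qed.

Lemma abs_tail_ge0 x : 0 <= abs_tail mu x.
Proof. by rewrite fine_ge0. Qed.

Lemma abs_tail_le1 x : abs_tail mu x <= 1.
Proof.
rewrite abs_tail_Ex; apply: Ex_le_cst => [|w].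
  exact: bounded_measurable_indic (measurable_tail x).
by rewrite indicE; case: (_ \in _).
Qed.

Lemma le_abs_tail x y : x <= y -> abs_tail mu y <= abs_tail mu x.
Proof.
move=> xy; rewrite !abs_tail_Ex; apply: le_Ex => [||w].
- exact: bounded_measurable_indic (measurable_tail y).
- exact: bounded_measurable_indic (measurable_tail x).
rewrite !indicE ler_nat; have [hy|//] := boolP (w \in [set z | y <= `|z|]).
rewrite inE /= in hy; rewrite mem_set//=.
exact: le_trans hy.
Qed.

(** The strict inequality makes the cut complementary to the event [u <= |x|] of [abs_tail]. *)
Definition truncation (u x : R) : R := if `|x| < u then x else 0.

Lemma truncation_norm_le u x : 0 <= u -> `|truncation u x| <= u.
Proof. by move=> u0; rewrite /truncation; case: ifP => [/ltW//|_]; rewrite normr0. Qed.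

Lemma measurable_truncation u :
  measurable_fun [set: measurableTypeR R] (truncation u : measurableTypeR R -> R).
Proof.
apply: (@measurable_fun_ifT _ _ (measurableTypeR R) (measurableTypeR R) id
  (fun=> 0) (fun x : R => `|x| < u)) => //.
apply: (@measurable_fun_ltr _ (measurableTypeR R) R setT (fun x : R => `|x|) (fun=> u)) => //.
exact: normr_measurable.
Qed.

Lemma bounded_measurable_truncation u :
  bounded_measurable (truncation u : measurableTypeR R -> R).
Proof.
split; first exact: measurable_truncation.
exists `|u| => x; rewrite /truncation; case: ifP => [xu|_]; last by rewrite normr0.
exact: le_trans (ltW xu) (ler_norm _).
Qed.

Definition truncated_variance (u : R) : R :=
  Ex mu (fun x : measurableTypeR R => truncation u x ^+ 2).

(** Raising the level adds squares of at most [u' ^+ 2], on an event contained in the tail at [u].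
    Iterated along dyadic points, this controls the growth of the variance. *)
Lemma truncated_variance_step u u' : 0 <= u <= u' ->
  truncated_variance u' <= truncated_variance u + u' ^+ 2 * abs_tail mu u.
Proof.
move=> /andP[u0 uu']; rewrite abs_tail_Ex.
have b1 : bounded_measurable (\1_[set y : measurableTypeR R | u <= `|y|] : _ -> R).
  exact: bounded_measurable_indic (measurable_tail u).
have bt v : bounded_measurable (fun x : measurableTypeR R => truncation v x ^+ 2).
  exact: bounded_measurableX (bounded_measurable_truncation v).
rewrite -ExZ// -ExD//; last exact: bounded_measurableZ.
apply: le_Ex => // [|x].
  by apply: bounded_measurableD => //; exact: bounded_measurableZ.
rewrite indicE /truncation; have [xu|xu] := ltP `|x| u.
  rewrite (lt_le_trans xu uu') lerDl mulr_ge0// sqr_ge0//.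
rewrite mem_set//= mulr1 expr0n add0r; case: ifP => [xu'|_]; last by rewrite expr0n sqr_ge0.
by rewrite -(real_normK (num_real x)) lerXn2r// ?nnegrE ?(le_trans u0 uu')// ltW.
Qed.

Lemma truncated_variance_mono u u' : u <= u' ->
  truncated_variance u <= truncated_variance u'.
Proof.
move=> uu'; apply: le_Ex => [||x].
- exact: bounded_measurableX (bounded_measurable_truncation u).
- exact: bounded_measurableX (bounded_measurable_truncation u').
rewrite /truncation; case: ifP => xu; last by rewrite expr0n sqr_ge0.
by rewrite (lt_le_trans xu uu').
Qed.

Lemma truncated_variance_le u : 0 <= u -> truncated_variance u <= u ^+ 2.
Proof.
move=> u0; apply: Ex_le_cst => [|x].
  exact: bounded_measurableX (bounded_measurable_truncation u).
rewrite -real_normK ?num_real// lerXn2r ?nnegrE//.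
exact: truncation_norm_le.
Qed.

(** The cut is an odd function. This is where the symmetry of the law acts: it kills the first
    moments in the trace. *)
Lemma truncation_centered u : symmetric_law mu ->
  Ex mu (truncation u : measurableTypeR R -> R) = 0.
Proof.
move=> smu; have bt := bounded_measurable_truncation u.
have mN : measurable_fun [set: measurableTypeR R]
    (fun x : measurableTypeR R => - x : measurableTypeR R).
  exact: oppr_measurable.
have lN : has_law mu (fun x : measurableTypeR R => - x) mu.
  by split => // B mB; rewrite -smu.
have := Ex_law lN bt.
have -> : (fun w : measurableTypeR R => truncation u (- w)) = (fun w => (-1) * truncation u w).
  by apply/funext => w; rewrite /truncation normrN mulN1r; case: ifP => //; rewrite oppr0.
rewrite ExZ//; lra.
Qed.

Variable alpha : R.
Hypothesis alpha0 : 0 < alpha.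
Hypothesis rv : regularly_varying alpha mu.

(** A zero of the tail would persist up to infinity and make the ratio that tends to 1 vanish. *)
Lemma abs_tail_gt0 x : 0 < abs_tail mu x.
Proof.
have [L [_ L0 _] hL] := rv.
suff [y xy y0] : exists2 y, x <= y & 0 < abs_tail mu y.
  by apply: lt_le_trans y0 _; exact: le_abs_tail.
have [y xy hy] := pinfty_ex_ge (num_real x) (cvgr_gt _ hL _ ltr01).
exists y => //; rewrite lt_neqAle abs_tail_ge0 andbT eq_sym; apply/eqP => y0.
by rewrite y0 mul0r ltxx in hy.
Qed.

Lemma abs_tail_ratio a : 0 < a ->
  abs_tail mu (a * x) / abs_tail mu x @[x --> +oo] --> a `^ (- alpha).
Proof.
move=> a0; have [L [_ L0 sL] hL] := rv.
have ay : a * x @[x --> +oo] --> +oo.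
  apply/cvgryPge => A; apply: filterS (nbhs_pinfty_ge (num_real (a^-1 * A))) => x.
  by rewrite ler_pdivrMl.
have hLa : abs_tail mu (a * x) / ((a * x) `^ (- alpha) * L (a * x)) @[x --> +oo] --> (1 : R).
  exact: (cvg_comp _ _ ay hL).
have hLV : (abs_tail mu x / (x `^ (- alpha) * L x))^-1 @[x --> +oo] --> (1 : R).
  by rewrite -[X in _ --> X]invr1; apply: cvgV => //; exact: oner_neq0.
suff : abs_tail mu (a * x) / ((a * x) `^ (- alpha) * L (a * x)) *
    (abs_tail mu x / (x `^ (- alpha) * L x))^-1 * (L (a * x) / L x) *
    a `^ (- alpha) @[x --> +oo] --> 1 * 1 * 1 * a `^ (- alpha); last first.
  apply: cvgM; last exact: cvg_cst.
  by apply: cvgM; [exact: cvgM|exact: sL].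
rewrite !mul1r; apply: cvg_trans; apply: near_eq_cvg; near=> x => /=.
have x0 : 0 < x by near: x; apply: nbhs_pinfty_gt; exact: num_real.
rewrite powRM ?ltW//.
have h1 := abs_tail_gt0 x; have h2 := L0 _ x0; have h3 := L0 _ (mulr_gt0 a0 x0).
have h4 : 0 < x `^ (- alpha) by rewrite powR_gt0.
have h5 : 0 < a `^ (- alpha) by rewrite powR_gt0.
by field; rewrite !gt_eqF.
Unshelve. all: by end_near. Qed.

(** With [h = 2^(-alpha)], [alpha < 4] gives [sqrt h > 1/4] and [h < 1] gives [sqrt h > h]; so [q]
    fits between [max(h, 1/4)] and [sqrt h], and then [p] between [q^2] and [h]. The inequality
    [4 q > 1] lets the last dyadic step dominate the bound on the variance, and [q^2 < p] makes that
    bound negligible. *)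
Lemma dyadic_tail : alpha < 4 -> exists p q x0 : R,
  [/\ 0 < p, p <= 1, 0 < q < 1, q ^+ 2 < p & 1 < 4 * q] /\
  (0 < x0 /\ forall x, x0 <= x ->
    p * abs_tail mu x <= abs_tail mu (2 * x) <= q * abs_tail mu x).
Proof.
move=> alpha4; pose h : R := 2 `^ (- alpha).
have h1 : h < 1.
  rewrite /h powRN -[ltRHS]invr1 ltf_pV2 ?posrE ?powR_gt0//.
  by apply: powR_gt1 => //; rewrite ltr1n.
have h2 : 16^-1 < h.
  have -> : 16^-1 = 2 `^ (- 4%:R) :> R.
    by rewrite powRN powR_mulrn// -natrX.
  rewrite /h /powR pnatr_eq0 /= ltr_expR ltr_pM2r ?ln_gt0 ?ltr1n//; lra.
pose s := Num.sqrt h.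
have s0 : 0 <= s by exact: sqrtr_ge0.
have sh : s ^+ 2 = h by rewrite sqr_sqrtr//; lra.
have s1 : s < 1 by rewrite -(@ltr_pXn2r _ 2)// ?nnegrE// expr1n sh.
have s4 : 4^-1 < s.
  rewrite -(@ltr_pXn2r _ 2)// ?nnegrE// ?invr_ge0// sh; apply: le_lt_trans h2.
  by rewrite exprVn -natrX.
have hs : h < s by rewrite -sh expr2 gtr_pMr//; lra.
pose q := (Num.max h 4^-1 + s) / 2.
have hm1 : h <= Num.max h 4^-1 by rewrite le_max lexx.
have hm2 : 4^-1 <= Num.max h 4^-1 by rewrite le_max lexx orbT.
have hm3 : Num.max h 4^-1 < s by rewrite gt_max hs s4.
have qs : q < s by rewrite /q; lra.
have hq : h < q by rewrite /q; lra.
have q4 : 4^-1 < q by rewrite /q; lra.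
have q2 : q ^+ 2 < h by rewrite -sh ltrXn2r//; lra.
pose p := (q ^+ 2 + h) / 2.
have hr := abs_tail_ratio (ltr0n R 2).
have [K [_ hK]] := cvgr_lt _ hr _ hq.
have hp : p < h by rewrite /p; lra.
have [K' [_ hK']] := cvgr_gt _ hr p hp.
exists p, q, (Num.max 1 (Num.max (K + 1) (K' + 1))); split; first split.
- rewrite /p; have := sqr_ge0 q; lra.
- rewrite /p; lra.
- apply/andP; split; lra.
- rewrite /p; lra.
- lra.
split=> [|x]; first by rewrite lt_max ltr01.
rewrite !ge_max => /and3P[x1 x2 x3].
have Hx := abs_tail_gt0 x.
apply/andP; split.
  by rewrite -ler_pdivlMr//; apply/ltW/hK'; lra.
by rewrite -ler_pdivrMr//; apply/ltW/hK; lra.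
Qed.

(** * The normalization and the choice of the truncation level *)

Section Scale.
Hypothesis alpha4 : alpha < 4.

Lemma abs_tail_small e : 0 < e -> exists2 x, 0 < x & abs_tail mu x <= e.
Proof.
move=> e0; have [p [q [x0 [[p0 p1 /andP[q0 q1] _ _] [x00 hx0]]]]] := dyadic_tail alpha4.
have hj j : abs_tail mu (2 ^+ j * x0) <= q ^+ j.
  elim: j => [|j IH]; first by rewrite !expr0 abs_tail_le1.
  rewrite !exprS -mulrA.
  have /andP[_ h] := hx0 (2 ^+ j * x0) (ler_peMl (ltW x00) (exprn_ege1 j (ler1n R 2))).
  apply: le_trans h _; last by rewrite ler_wpM2l// ltW.
have : (q ^+ j) @[j --> \oo] --> (0 : R) by apply: cvg_expr; rewrite gtr0_norm.
move=> /cvgr_lt/(_ _ e0)[j _ hq]; exists (2 ^+ j * x0); first by rewrite mulr_gt0// exprn_gt0.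
by apply: le_trans (hj j) _; apply/ltW/hq => /=.
Qed.

Let S (n : nat) := [set x : R | 0 < x /\ abs_tail mu x <= 2 * n.+1%:R ^- 2].

Let S0 n : S n !=set0.
Proof.
have [|x x0 hx] := @abs_tail_small (2 * n.+1%:R ^- 2); last by exists x.
by rewrite mulr_gt0// invr_gt0 exprn_gt0.
Qed.

Let Slb n : lbound (S n) 0.
Proof. by move=> x [/ltW]. Qed.

(** The value at the normalization itself is left aside: the tail may jump there, so comparisons are
    made strictly on either side. *)
Lemma abs_tail_lt_normalization n x : 0 < x < normalization mu n.+1 ->
  2 * n.+1%:R ^- 2 < abs_tail mu x.
Proof.
move=> /andP[x0 xb]; rewrite ltNge; apply/negP => hx; move: xb.
by rewrite ltNge => /negP; apply; apply: ge_inf => //; exists 0; exact: Slb.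
Qed.

Lemma abs_tail_gt_normalization n x : normalization mu n.+1 < x ->
  abs_tail mu x <= 2 * n.+1%:R ^- 2.
Proof.
move=> /(inf_lt (S0 n))[y [y0 hy] yx].
by apply: le_trans hy; apply: le_abs_tail; exact: ltW.
Qed.

Lemma nearN_sqr_ge (K : R) : \forall n \near \oo, K < n.+1%:R ^+ 2 :> R.
Proof.
apply: filterS (nbhs_infty_gtr K) => n /lt_le_trans; apply.
by rewrite -natrX ler_nat expnS expn1 (leq_trans (leqnSn n))// leq_pmulr.
Qed.

Lemma normalization_large K : \forall n \near \oo, K <= normalization mu n.+1.
Proof.
apply: filterS (nearN_sqr_ge (2 / abs_tail mu K)) => n hn.
apply: (lb_le_inf (S0 n)) => x [x0 hx].
rewrite leNgt; apply/negP => xK; have := le_abs_tail (ltW xK).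
have H0 := abs_tail_gt0 K; rewrite ltr_pdivrMr// in hn.
apply/negP; rewrite -ltNge; apply: le_lt_trans hx _.
by rewrite ltr_pdivrMr ?exprn_gt0// mulrC.
Qed.

(** For [y > 1] the level [2 * n.+1%:R ^- 2] is caught between the tails at [y b] and [b / y], and
    the ratios of the tail at [x b] to these tend to [(x / y)^(-alpha)] and [(x y)^(-alpha)]. A [y]
    close to 1 closes the gap. *)
Lemma tail_at_normalization x : 0 < x ->
  n.+1%:R ^+ 2 * abs_tail mu (x * normalization mu n.+1) @[n --> \oo] -->
  2 * x `^ (- alpha).
Proof.
move=> x0; set l := 2 * _.
have l0 : 0 < l by rewrite mulr_gt0// powR_gt0.
have by_ y : 0 < y -> y * normalization mu n.+1 @[n --> \oo] --> +oo.
  move=> y0; apply/cvgryPge => K; apply: filterS (normalization_large (y^-1 * K)) => n.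
  by rewrite ler_pdivrMl.
have ratio y : 0 < y -> abs_tail mu (x * normalization mu n.+1) /
    abs_tail mu (y * normalization mu n.+1) @[n --> \oo] --> (x / y) `^ (- alpha).
  move=> y0; have := cvg_comp _ _ (by_ y y0) (abs_tail_ratio (divr_gt0 x0 y0)).
  apply: cvg_trans; apply: near_eq_cvg; near=> n => /=.
  by rewrite mulrA divfK ?gt_eqF.
have powD y : 0 < y -> 2 * (x / y) `^ (- alpha) = l * y `^ alpha.
  move=> y0; rewrite powRM ?invr_ge0 ?ltW// mulrA -/l.
  by congr (_ * _); rewrite -powR_inv1 ?ltW// -powRrM mulN1r opprK.
have N0 n : 0 < n.+1%:R ^+ 2 :> R by rewrite exprn_gt0.
have powy e : 0 < e -> exists2 y : R, 1 < y & y `^ alpha <= 1 + e.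
  move=> e0; exists ((1 + e) `^ alpha^-1).
    by apply: powR_gt1; rewrite ?invr_gt0//; lra.
  by rewrite -powRrM mulVf ?gt_eqF// powRr1//; lra.
apply/cvgrPdist_le => e e0.
(* Half of [e] pays for replacing a power of [y] by 1, the other half for the error [e / 4] on a
   ratio, doubled by the factor 2 of the level. *)
pose e' := e / (2 * l).
have e'0 : 0 < e' by rewrite divr_gt0// mulr_gt0.
have le' : l * e' = e / 2 by rewrite /e'; field; rewrite gt_eqF.
have [y y1 ye] := powy _ e'0.
have y0 : 0 < y by lra.
have yV0 : 0 < y^-1 by rewrite invr_gt0.
have e2 : (e / 4) > 0 by rewrite divr_gt0.
have i1 : (x / y) `^ (- alpha) < (x / y) `^ (- alpha) + e / 4 by rewrite ltrDl.
have i2 : (x / y^-1) `^ (- alpha) - e / 4 < (x / y^-1) `^ (- alpha) by rewrite gtrBl.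
have R1 := cvgr_lt _ (ratio y y0) _ i1.
have R2 := cvgr_gt _ (ratio y^-1 yV0) _ i2.
near=> n.
have r1 : abs_tail mu (x * normalization mu n.+1) /
  abs_tail mu (y * normalization mu n.+1) < (x / y) `^ (- alpha) + e / 4.
  by near: n; exact: R1.
have r2 : (x / y^-1) `^ (- alpha) - e / 4 < abs_tail mu (x * normalization mu n.+1) /
  abs_tail mu (y^-1 * normalization mu n.+1).
  by near: n; exact: R2.
have b0 : 1 <= normalization mu n.+1 by near: n; exact: normalization_large.
set b := normalization mu n.+1 in b0 r1 r2 *.
have up : abs_tail mu (y * b) <= 2 * n.+1%:R ^- 2.
  by apply: abs_tail_gt_normalization; rewrite ltr_pMl//; lra.
have lo : 2 * n.+1%:R ^- 2 < abs_tail mu (y^-1 * b).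
  apply: abs_tail_lt_normalization; rewrite mulr_gt0//=; last lra.
  by rewrite -/b gtr_pMl ?invf_lt1//; lra.
have Hy := abs_tail_gt0 (y * b); have HyV := abs_tail_gt0 (y^-1 * b).
rewrite ltr_pdivrMr// in r1; rewrite ltr_pdivlMr// in r2.
set X := abs_tail mu (x * b) in r1 r2 *.
set N2 := n.+1%:R ^+ 2 : R.
have NN : N2 * N2^-1 = 1 by rewrite divff// gt_eqF// /N2.
have u1 := powD y y0; have u2 := powD y^-1 yV0.
have yV : y^-1 `^ alpha = (y `^ alpha)^-1.
  by rewrite -powR_inv1 ?ltW// -powRrM mulN1r powRN.
have ya0 : 0 < y `^ alpha by rewrite powR_gt0.
have yVe : 1 - e' <= y^-1 `^ alpha.
  rewrite yV -[leLHS]mulr1 -[leRHS]mul1r ler_pdivlMr// mulr1.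
  have [h|h] := leP (1 - e') 0; first by apply: (@le_trans _ _ 0) => //; rewrite mulr_le0_ge0// ltW.
  apply: le_trans (_ : (1 - e') * (1 + e') <= _); first by rewrite ler_wpM2l// ltW.
  have := sqr_ge0 e'; lra.
have U : N2 * X <= 2 * ((x / y) `^ (- alpha) + e / 4).
  apply: le_trans (_ : N2 * (((x / y) `^ (- alpha) + e / 4) * (2 * N2^-1)) <= _).
    rewrite ler_wpM2l ?(ltW (N0 n))//; apply: le_trans (ltW r1) _; rewrite ler_wpM2l//.
    by rewrite addr_ge0 ?powR_ge0// ltW.
  rewrite le_eqVlt; apply/orP; left; apply/eqP.
  transitivity (2 * ((x / y) `^ (- alpha) + e / 4) * (N2 * N2^-1)); first by ring.
  by rewrite NN mulr1.
have V : 2 * ((x / y^-1) `^ (- alpha) - e / 4) <= N2 * X.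
  have [h|h] := leP ((x / y^-1) `^ (- alpha) - e / 4) 0.
    apply: (@le_trans _ _ 0); first by rewrite mulr_ge0_le0.
    by rewrite mulr_ge0 ?abs_tail_ge0 ?(ltW (N0 n)).
  apply: le_trans (_ : N2 * (((x / y^-1) `^ (- alpha) - e / 4) * (2 * N2^-1)) <= _).
    rewrite le_eqVlt; apply/orP; left; apply/eqP.
    transitivity (2 * ((x / y^-1) `^ (- alpha) - e / 4) * (N2 * N2^-1)); last by ring.
    by rewrite NN mulr1.
  rewrite ler_wpM2l ?(ltW (N0 n))//; apply: le_trans (ltW r2); rewrite ler_wpM2l//; exact: ltW.
have w1 : l * y `^ alpha <= l * (1 + e') by rewrite ler_wpM2l// ltW.
have w2 : l * (1 - e') <= l * y^-1 `^ alpha by rewrite ler_wpM2l// ltW.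
rewrite ler_distl; apply/andP; split; lra.
Unshelve. all: by end_near. Qed.

Lemma dyadic_bracket (x0 b : R) : 0 < x0 -> x0 <= b ->
  exists J, 2 ^+ J * x0 <= b < 2 ^+ J.+1 * x0.
Proof.
move=> x00 hb.
have ex : exists j, b < 2 ^+ j * x0.
  exists (Num.truncn (b / x0)).+1; rewrite -ltr_pdivrMr//.
  apply: lt_le_trans (truncnS_gt _) _; rewrite -natrX ler_nat.
  by apply: ltnW; exact: ltn_expl.
case: (ex_minnP ex) => -[|J] hJ mJ; first by move: hJ; rewrite expr0 mul1r ltNge hb.
exists J; rewrite hJ andbT leNgt; apply/negP => /mJ; by rewrite ltnn.
Qed.

Lemma geometric_near (r C e : R) : 0 <= r < 1 -> 0 < C -> 0 < e ->
  exists i0, forall i, (i0 <= i)%N -> C * r ^+ i <= e.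
Proof.
move=> /andP[r0 r1] C0 e0.
have : (r ^+ j) @[j --> \oo] --> (0 : R) by apply: cvg_expr; rewrite ger0_norm.
move=> /cvgr_lt/(_ _ (divr_gt0 e0 C0))[i0 _ h]; exists i0 => i ii.
by have := ltW (h i ii); rewrite ler_pdivlMr// mulrC.
Qed.

(* With [2 ^ J * x0] comparable to the normalization, all the quantities involved
   are geometric in [J]. *)
Lemma dyadic_scale : exists p q x0 C : R,
  [/\ 0 < p <= 1, 0 < q < 1, q ^+ 2 < p, 1 < 4 * q & 0 < x0] /\ 0 < C /\
  (forall j, p * abs_tail mu (2 ^+ j * x0) <= abs_tail mu (2 ^+ j.+1 * x0)) /\
  (forall j, truncated_variance (2 ^+ j * x0) <= C * (4 * q) ^+ j) /\
  (forall J0, \forall n \near \oo, exists J, (J0 <= J)%N /\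
    [/\ 2 ^+ J * x0 <= normalization mu n.+1,
        n.+1%:R ^+ 2 * p ^+ J <= C,
        n.+1%:R ^- 2 <= C * q ^+ J &
        n.+1%:R ^+ 2 * abs_tail mu (2 ^+ J * x0) <= C]).
Proof.
have [p [q [x0 [[p0 p1 q01 qp q4] [x00 hx0]]]]] := dyadic_tail alpha4.
have /andP[q0 q1] := q01.
pose y j := 2 ^+ j * x0; pose H j := abs_tail mu (y j).
have y0 j : 0 < y j by rewrite mulr_gt0// exprn_gt0.
have yx j : x0 <= y j by rewrite ler_peMl ?exprn_ege1 ?ler1n// ltW.
have yS j : y j.+1 = 2 * y j by rewrite /y exprS mulrA.
have ymono j k : (j <= k)%N -> y j <= y k.
  by move=> jk; rewrite ler_wpM2r ?(ltW x00)// ler_weXn2l// ler1n.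
have HS j : p * H j <= H j.+1 <= q * H j by rewrite /H yS; exact: hx0.
have H0 j : 0 < H j by exact: abs_tail_gt0.
have Hp j : p ^+ j * H 0%N <= H j.
  elim: j => [|j IH]; first by rewrite expr0 mul1r.
  have /andP[h _] := HS j; apply: le_trans h; rewrite exprS -mulrA ler_wpM2l//; exact: ltW.
have Hq j : H j <= q ^+ j.
  elim: j => [|j IH]; first by rewrite expr0 abs_tail_le1.
  have /andP[_ h] := HS j; apply: le_trans h _; rewrite exprS ler_wpM2l//; exact: ltW.
pose V j := truncated_variance (y j).
(* The second summand gives [CV * (4 q - 1) >= 4 x0^2], where [4 x0^2 (4 q)^j] bounds the cost of a
   dyadic step; this closes the induction. The first summand covers [j = 0]. *)
pose CV := x0 ^+ 2 + 4 * x0 ^+ 2 / (4 * q - 1).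
have CV0 : 0 < CV.
  by rewrite addr_gt0 ?exprn_gt0// divr_gt0 ?mulr_gt0 ?exprn_gt0// subr_gt0.
have hV j : V j <= CV * (4 * q) ^+ j.
  elim: j => [|j IH].
    apply: le_trans (truncated_variance_le (ltW (y0 0%N))) _.
    rewrite /y expr0 mul1r mulr1 lerDl divr_ge0 ?subr_ge0 ?ltW//.
    by rewrite mulr_gt0// exprn_gt0.
  have hh : 0 <= y j <= y j.+1 by rewrite ltW//= ymono.
  apply: le_trans (truncated_variance_step hh) _; rewrite -/(V j) -/(H j).
  have e1 : y j.+1 ^+ 2 * H j <= 4 * x0 ^+ 2 * (4 * q) ^+ j.
    have -> : y j.+1 ^+ 2 = 4 * x0 ^+ 2 * 4 ^+ j.
      rewrite /y exprMn -exprM mulnC exprM expr2 -natrM exprS; ring.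
    rewrite [in leRHS]exprMn [leRHS]mulrA ler_wpM2l//.
    by rewrite mulr_ge0 ?exprn_ge0// mulr_ge0 ?exprn_ge0// ltW.
  have e2 : CV * (4 * q - 1) >= 4 * x0 ^+ 2.
    have -> : CV * (4 * q - 1) = x0 ^+ 2 * (4 * q - 1) + 4 * x0 ^+ 2.
      by rewrite /CV; field; rewrite gt_eqF// subr_gt0.
    by rewrite lerDr mulr_ge0 ?sqr_ge0// subr_ge0 ltW.
  have e3 : 4 * x0 ^+ 2 * (4 * q) ^+ j <= CV * (4 * q - 1) * (4 * q) ^+ j.
    by rewrite ler_wpM2r// exprn_ge0// mulr_ge0// ltW.
  rewrite [in leRHS]exprS; lra.
pose C1 := 2 / (p * H 0%N); pose C2 := q^-1; pose C3 := 2 / p.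
have C10 : 0 < C1 by rewrite divr_gt0// mulr_gt0.
have C20 : 0 < C2 by rewrite invr_gt0.
have C30 : 0 < C3 by rewrite divr_gt0.
pose C := CV + C1 + C2 + C3.
have C0 : 0 < C by rewrite addr_gt0// addr_gt0// addr_gt0.
exists p, q, x0, C; split; first by split=> //; rewrite p0.
split=> //; split; first by move=> j; have /andP[] := HS j.
split.
  move=> j; apply: le_trans (hV j) _; rewrite ler_wpM2r ?exprn_ge0 ?mulr_ge0 ?(ltW q0)//.
  by rewrite /C; lra.
move=> J0.
near=> n.
have N0 : 0 < n.+1%:R ^+ 2 :> R by rewrite exprn_gt0.
(* Excludes [J = 0], so that [J.-1] below is a genuine predecessor. *)
have bb : x0 * 2 <= normalization mu n.+1 by near: n; exact: normalization_large.
(* Since [n.+1%:R ^+ 2 * p ^+ J] stays bounded, a large [n] forces [J0 <= J]. *)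
have big : C1 / p ^+ J0 < n.+1%:R ^+ 2 by near: n; exact: nearN_sqr_ge.
set b := normalization mu n.+1 in bb *.
have [|J /andP[J1 J2]] := @dyadic_bracket x0 b x00; first lra.
have h1 : H J.+1 <= 2 * n.+1%:R ^- 2 by exact: abs_tail_gt_normalization.
have bp : n.+1%:R ^+ 2 * p ^+ J <= C1.
  have := Hp J.+1; rewrite exprS => h.
  rewrite /C1 ler_pdivlMr ?mulr_gt0//.
  have := le_trans h h1; rewrite ler_pdivlMr//; lra.
have J1' : (0 < J)%N.
  case: (posnP J) => // Jz; move: J2; rewrite Jz expr1; lra.
exists J; split.
  rewrite leqNgt; apply/negP => JJ.
  move: big; rewrite ltNge => /negP; apply; rewrite ler_pdivlMr ?exprn_gt0//.
  apply: le_trans bp; rewrite ler_wpM2l ?(ltW N0)//.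
  by rewrite ler_wiXn2l ?(ltW p0)// ltnW.
split => //.
- by apply: le_trans bp _; rewrite /C; lra.
(* The bracket allows [2 ^+ J * x0] to equal the normalization, where the tail is not controlled;
   one step lower the inequality is strict. *)
- have : 2 * n.+1%:R ^- 2 < H J.-1.
    apply: abs_tail_lt_normalization; rewrite y0 /=.
    apply: lt_le_trans J1; rewrite -/(y J) -{2}(prednK J1') yS.
    by rewrite ltr_pMl ?ltr1n.
  move=> h; have h2 := Hq J.-1.
  have e1 : q ^+ J.-1 = C2 * q ^+ J.
    by rewrite -{2}(prednK J1') exprS /C2 mulKf// gt_eqF.
  have : 0 <= n.+1%:R ^- 2 :> R by rewrite invr_ge0 ltW.
  have : C2 * q ^+ J <= C * q ^+ J.
    by rewrite ler_wpM2r ?exprn_ge0 ?(ltW q0)// /C; lra.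
  move=> hC hn; apply: le_trans hC; rewrite -e1; apply: le_trans h2; apply: ltW.
  by apply: le_lt_trans h; rewrite ler_peMl// ler1n.
- apply: le_trans (_ : C3 <= _); last by rewrite /C; lra.
  have /andP[h _] := HS J; have := le_trans h h1.
  by rewrite ler_pdivlMr// /C3 ler_pdivlMr// -/(H J); lra.
Unshelve. all: by end_near. Qed.

(** Here [u] lies [i] dyadic steps below [2 ^+ J * x0] and [M = D * r ^+ i], with [i] a fixed
    fraction of [J]. The order [2 ^ kappa.+1] is chosen before [e], because the moment bound carries
    a constant depending on it which [e] must compensate. *)
Lemma truncation_scale : exists kappa : nat, forall e, 0 < e ->
  \forall n \near \oo, exists u M : R,
  [/\ 0 < u, 0 < M, M <= e & u <= M * normalization mu n.+1] /\
  [/\ n.+1%:R * truncated_variance u <= M ^+ 2 * normalization mu n.+1 ^+ 2,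
      n.+1%:R ^+ 3 * abs_tail mu u ^+ 2 <= e,
      n.+1%:R * abs_tail mu u <= e &
      n.+1%:R * M ^+ (2 ^ kappa.+1) <= e].
Proof.
have [p [q [x0 [C [[/andP[p0 p1] /andP[q0 q1] qp q4 x00]]]]]] := dyadic_scale.
move=> [C0 [Hp [HV scale]]].
have C10 : 0 <= C + 1 by rewrite addr_ge0// ltW.
have CC : C <= (C + 1) ^+ 2.
  by have := sqr_ge0 C; rewrite sqrrD1 mulr2n; lra.
pose y j := 2 ^+ j * x0; have y0 j : 0 < y j by rewrite mulr_gt0// exprn_gt0.
(* From [(n q^J)^2 = (n^2 p^J) t^J], the decay of the variance relative to the normalization is
   governed by [t]. *)
pose t := q ^+ 2 / p.
have t0 : 0 < t by rewrite divr_gt0// exprn_gt0.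
have t1 : t < 1 by rewrite ltr_pdivrMr// mul1r.
(* Bernoulli's inequality, obtained by squaring twice, gives [t <= r^4]; besides [r >= 1/2], so that
   [M] dominates [u / b], which is at most [2^(-i)]. *)
pose r := 1 - (1 - t) / 4.
have r0 : 0 < r by rewrite /r; lra.
have r1 : r < 1 by rewrite /r; lra.
have r2 : 2^-1 <= r by rewrite /r; lra.
have rt : t <= r ^+ 4.
  have -> : r ^+ 4 = (r ^+ 2) ^+ 2 by rewrite -exprM.
  have h1 : 1 - (1 - t) / 2 <= r ^+ 2.
    have -> : r ^+ 2 = 1 - (1 - t) / 2 + ((1 - t) / 4) ^+ 2 by rewrite /r; field.
    by rewrite lerDl sqr_ge0.
  apply: le_trans (_ : (1 - (1 - t) / 2) ^+ 2 <= _); last first.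
    by rewrite lerXn2r ?nnegrE//; lra.
  have -> : (1 - (1 - t) / 2) ^+ 2 = t + ((1 - t) / 2) ^+ 2 by field.
  by rewrite lerDl sqr_ge0.
(* [K0] makes [i = J %/ K0] small enough for rows with two large entries to be
   unlikely, then [kappa] makes the moment order large compared with [K0]. *)
have [K0 hK0] : exists K0, q ^+ K0.+1 <= p ^+ 4 / 2.
  have hq : 0 <= q < 1 by rewrite ltW.
  have hp : 0 < p ^+ 4 / 2 by rewrite divr_gt0// exprn_gt0.
  have [i0 h] := geometric_near hq ltr01 hp.
  by exists i0; have := h i0.+1 (leqnSn i0); rewrite mul1r.
have [kappa hkappa] : exists kappa, (r ^+ 2) ^+ (2 ^ kappa.+1) <= p ^+ K0.+1 / 2.
  have hr : 0 <= r ^+ 2 < 1.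
    by rewrite exprn_ge0 ?(ltW r0)//= -[ltRHS](expr1n _ 2) ltrXn2r// ltW.
  have hp : 0 < p ^+ K0.+1 / 2 by rewrite divr_gt0// exprn_gt0.
  have [i0 h] := geometric_near hr ltr01 hp.
  exists i0; have := h (2 ^ i0.+1)%N _; rewrite mul1r; apply.
  by apply: leq_trans (leqnSn i0) (ltnW _); exact: ltn_expl.
exists kappa => e e0.
(* The inequality [D * x0 >= C + 1] absorbs the constants of the variance bound. *)
pose D := 1 + (C + 1) / x0.
have D1 : 1 <= D by rewrite lerDl divr_ge0 ?(ltW x00).
have D0 : 0 < D by apply: lt_le_trans D1.
(* The [e ^+ 2] serves the bound on [n H(u)], whose square is at most [n^3 H(u)^2]. *)
pose e1 := Num.min e (e ^+ 2).
have e10 : 0 < e1 by rewrite lt_min e0 exprn_gt0.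
(* Bounds are proved on squares, since the scale controls [n^2], and each square will be at most a
   constant times [2^(-i)]. *)
have hbnd (f X : R) (i : nat) (c : R) : 0 < f -> X ^+ 2 <= c * 2^-1 ^+ i ->
    (c + 1) * 2^-1 ^+ i <= f ^+ 2 -> X <= f.
  move=> f0 h1 h2; rewrite leNgt; apply/negP => fX.
  have : f ^+ 2 < X ^+ 2 by rewrite ltrXn2r// ltW.
  have : 0 <= 2^-1 ^+ i :> R by rewrite exprn_ge0// invr_ge0.
  lra.
pose cA := C ^+ 4 * C.
pose cB := C * D ^+ (2 * 2 ^ kappa.+1) / p ^+ K0.+1.
have cA0 : 0 <= cA by rewrite mulr_ge0 ?exprn_ge0 ?(ltW C0).
have cB0 : 0 <= cB.
  by rewrite divr_ge0 ?exprn_ge0 ?(ltW p0)// mulr_ge0 ?exprn_ge0 ?(ltW D0) ?(ltW C0).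
have half01 : 0 <= (2^-1 : R) < 1.
  by rewrite invr_ge0 ler0n /= invf_lt1 ?ltr1n.
have e2 : 0 < e ^+ 2 by rewrite exprn_gt0.
have r01 : 0 <= r < 1 by rewrite ltW.
have e12 : 0 < e1 ^+ 2 by rewrite exprn_gt0.
have [iA hiA] := geometric_near half01 (ltr_wpDl cA0 ltr01) e12.
have [iB hiB] := geometric_near half01 (ltr_wpDl cB0 ltr01) e2.
have [iM hiM] := geometric_near r01 D0 e0.
pose i0 := maxn iA (maxn iB iM).
apply: filterS (scale (i0 * K0.+1)%N) => n [J [hJ [J1 J2 J3 J4]]].
pose i := (J %/ K0.+1)%N.
have ii0 : (i0 <= i)%N by rewrite leq_divRL.
have iAi : (iA <= i)%N by apply: leq_trans ii0; rewrite leq_maxl.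
have iBi : (iB <= i)%N by apply: leq_trans ii0; rewrite /i0 leq_max (leq_maxl iB) orbT.
have iMi : (iM <= i)%N by apply: leq_trans ii0; rewrite /i0 leq_max (leq_maxr iB) orbT.
have iJ : (i <= J)%N by exact: leq_div.
have KiJ : (K0.+1 * i <= J)%N by rewrite mulnC leq_trunc_div.
have JKi : (J <= K0.+1 * i.+1)%N.
  by rewrite mulnC ltnW// -ltn_divLR.
set b := normalization mu n.+1 in J1 *.
pose N : R := n.+1%:R; have N1 : 1 <= N by rewrite ler1n.
have N0 : 0 < N by apply: lt_le_trans N1.
rewrite -/N in J2 J3 J4 *.
have b0 : 0 < b by apply: lt_le_trans J1; exact: y0.
pose u := y (J - i)%N; pose M := D * r ^+ i.
have M0 : 0 < M by rewrite mulr_gt0// exprn_gt0.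
exists u, M.
(* Each dyadic step back multiplies the tail by at most [p^-1]. *)
have hu : N ^+ 2 * abs_tail mu u * p ^+ i <= C.
  have h k : (k <= J)%N -> p ^+ k * abs_tail mu (y (J - k)%N) <= abs_tail mu (y J).
    elim: k => [|k IH] kJ; first by rewrite expr0 mul1r subn0.
    apply: le_trans (IH (ltnW kJ)); rewrite exprSr -mulrA ler_wpM2l ?exprn_ge0 ?(ltW p0)//.
    by have := Hp (J - k.+1)%N; rewrite -subSn.
  apply: le_trans J4; rewrite -mulrA ler_wpM2l ?exprn_ge0 ?(ltW N0)//.
  by rewrite mulrC; exact: h.
have pi0 : 0 < p ^+ i by rewrite exprn_gt0.
have Hu0 := abs_tail_ge0 u.
(* The square is [(n^2 H(u))^4] times [n^-2]: the first factor costs [p^(-4 i)], the second gains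
   [q^J <= (p^4 / 2)^i], and [2^(-i)] is left. *)
have A2 : N ^+ 3 * abs_tail mu u ^+ 2 <= e1.
  apply: (hbnd _ _ i cA) => //; last exact: hiA.
  have q_le : q ^+ J <= (p ^+ 4 / 2) ^+ i.
    apply: le_trans (_ : (q ^+ K0.+1) ^+ i <= _).
      by rewrite -exprM ler_wiXn2l// ltW.
    by rewrite lerXn2r ?nnegrE ?exprn_ge0 ?divr_ge0 ?exprn_ge0 ?(ltW q0) ?(ltW p0).
  have p4 : 0 < (p ^+ 4) ^+ i by rewrite !exprn_gt0.
  rewrite -(ler_pM2l p4).
  have -> : (p ^+ 4) ^+ i * (N ^+ 3 * abs_tail mu u ^+ 2) ^+ 2 =
     (N ^+ 2 * abs_tail mu u * p ^+ i) ^+ 4 * N ^- 2.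
    by rewrite -exprM mulnC exprM; field; rewrite gt_eqF.
  apply: le_trans (_ : C ^+ 4 * (C * q ^+ J) <= _).
    apply: ler_pM; rewrite ?exprn_ge0 ?invr_ge0 ?exprn_ge0 ?(ltW N0)//.
      by rewrite !mulr_ge0 ?exprn_ge0 ?(ltW N0) ?(ltW p0).
    rewrite lerXn2r ?nnegrE ?(ltW C0)//.
    by rewrite !mulr_ge0 ?exprn_ge0 ?(ltW N0) ?(ltW p0).
  rewrite mulrA -/cA.
  apply: le_trans (ler_wpM2l cA0 q_le) _.
  by rewrite exprMn mulrCA.
split; split.
- exact: y0.
- exact: M0.
- exact: hiM.
- apply: le_trans (_ : r ^+ i * b <= _).
    have -> : u = 2^-1 ^+ i * (2 ^+ J * x0).
      rewrite /u /y -{2}(subnK iJ) exprD mulrA mulrCA -mulrA; congr (_ * _).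
      by rewrite -exprMn mulVf ?pnatr_eq0// expr1n mul1r.
    apply: ler_pM => //; rewrite ?exprn_ge0 ?invr_ge0 ?(ltW (y0 J))//.
    by rewrite lerXn2r ?nnegrE ?invr_ge0 ?(ltW r0).
  by rewrite ler_pM2r// /M ler_peMl// exprn_ge0// ltW.
- have hy2 : y J ^+ 2 <= b ^+ 2 by rewrite lerXn2r ?nnegrE ?(ltW b0) ?(ltW (y0 J)).
  apply: le_trans (_ : M ^+ 2 * y J ^+ 2 <= _); last by rewrite ler_wpM2l ?sqr_ge0.
  have V1 : truncated_variance u <= C * (4 * q) ^+ J.
    apply: le_trans (HV J); apply: truncated_variance_mono.
    rewrite /u /y ler_wpM2r ?(ltW x00)// ler_weXn2l ?leq_subr// ler1n//.
  have Nq : N * q ^+ J <= (C + 1) * r ^+ (2 * i).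
    have C2 : 0 <= (C + 1) * r ^+ (2 * i) by rewrite mulr_ge0 ?exprn_ge0 ?(ltW r0).
    rewrite -(@ler_pXn2r _ 2)// ?nnegrE//; last by rewrite mulr_ge0 ?exprn_ge0 ?(ltW N0) ?(ltW q0).
    have pJ : 0 < p ^+ J by rewrite exprn_gt0.
    have -> : (N * q ^+ J) ^+ 2 = (N ^+ 2 * p ^+ J) * t ^+ J.
      rewrite /t exprMn exprMn exprVn -!exprM (mulnC 2); field.
      by rewrite expf_neq0// gt_eqF.
    have tJ : t ^+ J <= (r ^+ (2 * i)) ^+ 2.
      apply: le_trans (_ : (r ^+ 4) ^+ J <= _).
        by rewrite lerXn2r ?nnegrE ?exprn_ge0 ?(ltW t0) ?(ltW r0).
      by rewrite -!exprM ler_wiXn2l ?(ltW r0) ?(ltW r1)// mulnAC leq_mul.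
    rewrite [in leRHS]exprMn; apply: ler_pM => //.
    - by rewrite mulr_ge0 ?exprn_ge0 ?(ltW N0) ?(ltW p0).
    - by rewrite exprn_ge0// ltW.
    - exact: le_trans J2 CC.
  apply: le_trans (_ : C * 4 ^+ J * ((C + 1) * r ^+ (2 * i)) <= _).
    apply: le_trans (_ : N * (C * (4 * q) ^+ J) <= _); first by rewrite ler_wpM2l// ltW.
    rewrite exprMn; have -> : N * (C * (4 ^+ J * q ^+ J)) = C * 4 ^+ J * (N * q ^+ J) by ring.
    by rewrite ler_wpM2l// mulr_ge0 ?exprn_ge0 ?(ltW C0).
  have -> : M ^+ 2 * y J ^+ 2 = D ^+ 2 * x0 ^+ 2 * (4 ^+ J * r ^+ (2 * i)).
    rewrite /M /y !exprMn -!exprM (mulnC J) (mulnC i) !exprM (_ : 2 ^+ 2 = 4); first by ring.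
    by rewrite expr2 -natrM.
  have -> : C * 4 ^+ J * ((C + 1) * r ^+ (2 * i)) = C * (C + 1) * (4 ^+ J * r ^+ (2 * i)) by ring.
  rewrite ler_wpM2r ?mulr_ge0 ?exprn_ge0 ?(ltW r0)//.
  apply: le_trans (_ : (C + 1) ^+ 2 <= _).
    by rewrite expr2 ler_wpM2r ?lerDl.
  rewrite -exprMn lerXn2r ?nnegrE ?mulr_ge0 ?(ltW D0) ?(ltW x00)//.
  by rewrite /D mulrDl divfK ?gt_eqF// mul1r lerDr ltW.
- by apply: le_trans A2 _; rewrite ge_min lexx.
- rewrite -(@ler_pXn2r _ 2)// ?nnegrE ?mulr_ge0 ?(ltW N0) ?(ltW e0)//.
  apply: le_trans (_ : e1 <= _); last by rewrite ge_min lexx orbT.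
  apply: le_trans A2; rewrite exprMn ler_wpM2r ?sqr_ge0//.
  by rewrite ler_weXn2l.
(* Here [n^2] costs [p^(-J)], at most a factor [p^(-K0.+1)] per unit of [i] and one more for the
   remainder of the division; the choice of [kappa] turns this into [2^(-i)]. *)
- apply: (hbnd _ _ i cB) => //; last exact: hiB.
  set k := (2 ^ kappa.+1)%N in cB cB0 hkappa hiB *.
  have pK : 0 < p ^+ K0.+1 by rewrite exprn_gt0.
  have pKi : 0 < (p ^+ K0.+1) ^+ i by rewrite exprn_gt0.
  have -> : (N * M ^+ k) ^+ 2 = N ^+ 2 * D ^+ (2 * k) * ((r ^+ 2) ^+ k) ^+ i.
    have rE : ((r ^+ i) ^+ k) ^+ 2 = ((r ^+ 2) ^+ k) ^+ i.
      by rewrite -!exprM mulnCA mulnA mulnC.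
    rewrite /M exprMn [(D * _) ^+ k]exprMn [(D ^+ k * _) ^+ 2]exprMn rE.
    by rewrite -[(D ^+ k) ^+ 2]exprM (mulnC k) mulrA.
  have N2 : N ^+ 2 <= C / p ^+ K0.+1 / (p ^+ K0.+1) ^+ i.
    rewrite !ler_pdivlMr// -mulrA -exprSr -exprM; apply: le_trans J2.
    by rewrite ler_wpM2l ?exprn_ge0 ?(ltW N0)// ler_wiXn2l// ltW.
  have r2i : ((r ^+ 2) ^+ k) ^+ i <= (p ^+ K0.+1) ^+ i * 2^-1 ^+ i.
    by rewrite -exprMn lerXn2r ?nnegrE ?exprn_ge0 ?divr_ge0 ?exprn_ge0 ?(ltW r0) ?(ltW p0).
  apply: le_trans (_ : C / p ^+ K0.+1 / (p ^+ K0.+1) ^+ i * D ^+ (2 * k) *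
      ((p ^+ K0.+1) ^+ i * 2^-1 ^+ i) <= _).
    apply: ler_pM => //; rewrite ?mulr_ge0 ?exprn_ge0 ?(ltW N0) ?(ltW D0) ?(ltW r0)//.
    by rewrite ler_wpM2r ?exprn_ge0 ?(ltW D0).
  rewrite le_eqVlt; apply/orP; left; apply/eqP; rewrite /cB; field.
  by rewrite !expf_neq0 ?gt_eqF.
Qed.

End Scale.

End Tail.

(** * The good event *)

Lemma measurable_fun_le_set (R : realType) d (T : measurableType d) (f : T -> R) :
  (forall t, measurable [set w | f w <= t]) -> measurable_fun [set: T] f.
Proof.
move=> mf mD; apply: (measurability _ (RGenOInfty.measurableE R)) => //.
move=> _ [_ [t ->] <-]; rewrite setTI.
have -> : f @^-1` `]t, +oo[ = ~` [set w | f w <= t].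
  by apply/seteqP; split=> w /=; rewrite in_itv /= andbT ltNge => /negP.
exact: measurableC.
Qed.

(** By [lambda1_le_int] the event [lambda1 <= t] is a countable intersection, over integer vectors
    enumerated by [pickle], of inequalities linear in the entries. *)
Lemma measurable_lambda1 (R : realType) d (T : measurableType d) n
    (M : T -> 'M[R]_n.+1) : (forall w, (M w)^T = M w) ->
  (forall i j, measurable_fun [set: T] (fun w => M w i j)) ->
  measurable_fun [set: T] (fun w => lambda1 (M w)).
Proof.
move=> sM mM; apply: measurable_fun_le_set => t.
pose F (z : {ffun 'I_n.+1 -> int}) := [set w |
  bilin (M w) (int_vec z) (int_vec z) <= t * sqnorm (int_vec z)].
have -> : [set w | lambda1 (M w) <= t] =
    \bigcap_k (if unpickle k is Some z then F z else setT).
  apply/seteqP; split=> w /=.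
    move=> /(lambda1_le_int t (sM w)) h k _; case: unpickle => // z; exact: h.
  move=> h; apply/(lambda1_le_int t (sM w)) => z.
  by have := h (pickle z) I; rewrite pickleK.
apply: bigcapT_measurable => k; case: unpickle => // z.
have mB : measurable_fun [set: T] (fun w => bilin (M w) (int_vec z) (int_vec z)).
  under eq_fun do rewrite bilinE.
  apply: measurable_sum => i; apply: measurable_sum => j.
  apply: measurable_funM; last exact: measurable_cst.
  by apply: measurable_funM => //; exact: measurable_cst.
rewrite -[F z]setTI; have -> : F z = (fun w => bilin (M w) (int_vec z) (int_vec z)) @^-1`
    `]-oo, t * sqnorm (int_vec z)].
  by apply/seteqP; split=> w /=; rewrite in_itv.
by apply: mB => //; exact: measurable_itv.
Qed.

Section BadEvent.
Context {R : realType} {d : measure_display} {T : measurableType d}.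
Context {P : probability T R} {mu : probability (measurableTypeR R) R} {n : nat}.
Variable A : T -> 'M[R]_n.+1.
Hypothesis hA : iid_symmetric_matrix P A mu.
Hypothesis smu : symmetric_law mu.
Variable v : 'cV[R]_n.+1.
Hypothesis v1 : sqnorm v = 1.
Variables (b u M s e theta : R) (kappa : nat).
Hypotheses (b0 : 0 < b) (u0 : 0 < u) (M0 : 0 < M) (s01 : 0 < s < 1) (e0 : 0 < e).
Hypothesis theta0 : 0 <= theta.
Hypothesis uMb : u <= M * b.
Hypothesis var : n.+1%:R * truncated_variance mu u <= M ^+ 2 * b ^+ 2.

Let K := (2 ^ kappa.+1)%N.
Let N : R := n.+1%:R.
Let H := abs_tail mu u.
Let large : measurableTypeR R -> R := \1_[set y : measurableTypeR R | u <= `|y|].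

Definition small_part w : 'M[R]_n.+1 := map_mx (fun x => truncation u x / b) (A w).

Definition large_part w : 'M[R]_n.+1 := b^-1 *: A w - small_part w.

(** Each nonnegative term is at least 1 when its requirement fails: one large entry at most per row,
    none on the diagonal, mass of [v] at most [s ^+ 2] on the rows with a large entry, trace at most
    [e ^+ K]. Below 1 all four hold, so a bound on one mean replaces four estimates of
    probabilities. *)
Definition badness w : R :=
  \sum_i \sum_j \sum_(k | k != j) large (A w i j) * large (A w i k) +
  \sum_i large (A w i i) +
  s ^- 2 * (\sum_i \sum_j v i 0 ^+ 2 * large (A w i j)) +
  e ^- K * \tr (small_part w ^+ K).

Let sA w : (A w)^T = A w.
Proof. by have [] := hA. Qed.

Lemma large01 x : large x = ((u <= `|x|)%R)%:R.
Proof. by rewrite /large indicE; congr (nat_of_bool _)%:R; apply/idP/idP; rewrite inE. Qed.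

Let large_ge0 x : 0 <= large x.
Proof. by rewrite large01. Qed.

Let bounded_large : bounded_measurable large.
Proof. rewrite /large; exact: bounded_measurable_indic (measurable_tail u). Qed.

Lemma small_part_sym w : (small_part w)^T = small_part w.
Proof. by rewrite /small_part map_trmx sA. Qed.

Lemma large_part_sym w : (large_part w)^T = large_part w.
Proof. by rewrite /large_part linearB linearZ /= sA small_part_sym. Qed.

Lemma small_large_sum w : small_part w + large_part w = b^-1 *: A w.
Proof. by rewrite /large_part addrC subrK. Qed.

Lemma large_part_eq0 w i j : `|A w i j| < u -> large_part w i j = 0.
Proof. by move=> h; rewrite !mxE /truncation h mulrC subrr. Qed.

Lemma large_part_entry w i j : u <= `|A w i j| -> large_part w i j = A w i j / b.
Proof. by move=> h; rewrite !mxE /truncation ltNge h /= mul0r subr0 mulrC. Qed.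

Lemma bounded_measurable_badness : bounded_measurable badness.
Proof.
have bl i j : bounded_measurable (fun w => large (A w i j)).
  exact: (bounded_measurable_entry hA _ _ bounded_large).
apply: bounded_measurableD; [apply: bounded_measurableD; [apply: bounded_measurableD|]|].
- apply: bounded_measurable_sum => i; apply: bounded_measurable_sum => j.
  by apply: bounded_measurable_sum => k; exact: bounded_measurableM.
- exact: bounded_measurable_sum.
- apply: bounded_measurableZ; apply: bounded_measurable_sum => i.
  by apply: bounded_measurable_sum => j; exact: bounded_measurableZ.
apply: bounded_measurableZ; apply: bounded_measurable_sum => i.
apply: (bounded_measurable_pow hA) => /=.
by under eq_fun do rewrite mulrC; apply: bounded_measurableZ; exact: bounded_measurable_truncation.
Qed.

(** The exponent [K] is even, so the trace is the sum of the squared entries of a symmetric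
    power. *)
Let trace_ge0 w : 0 <= \tr (small_part w ^+ K).
Proof.
have -> : small_part w ^+ K = small_part w ^+ (2 ^ kappa) *m (small_part w ^+ (2 ^ kappa))^T.
  have -> : (small_part w ^+ (2 ^ kappa))^T = small_part w ^+ (2 ^ kappa).
    elim: (2 ^ kappa)%N => [|k IH]; first by rewrite expr0 trmx1.
    by rewrite exprS trmx_mul IH small_part_sym -[LHS]exprSr exprS.
  transitivity (small_part w ^+ (2 ^ kappa) * small_part w ^+ (2 ^ kappa)); last by [].
  by rewrite -exprD /K expnS mul2n addnn.
apply: sumr_ge0 => i _; rewrite mxE; apply: sumr_ge0 => j _.
by rewrite mxE -expr2 sqr_ge0.
Qed.

Let term1 w := \sum_i \sum_j \sum_(k | k != j) large (A w i j) * large (A w i k).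
Let term2 w := \sum_i large (A w i i).
Let term3 w := s ^- 2 * (\sum_i \sum_j v i 0 ^+ 2 * large (A w i j)).
Let term4 w := e ^- K * \tr (small_part w ^+ K).

Let term1_ge0 w : 0 <= term1 w.
Proof.
by apply: sumr_ge0 => i _; apply: sumr_ge0 => j _; apply: sumr_ge0 => k _; exact: mulr_ge0.
Qed.
Let term2_ge0 w : 0 <= term2 w.
Proof. by apply: sumr_ge0. Qed.
Let term3_ge0 w : 0 <= term3 w.
Proof.
rewrite mulr_ge0 ?invr_ge0 ?sqr_ge0//; apply: sumr_ge0 => i _; apply: sumr_ge0 => j _.
by rewrite mulr_ge0// sqr_ge0.
Qed.
Let term4_ge0 w : 0 <= term4 w.
Proof. by rewrite mulr_ge0 ?trace_ge0// invr_ge0 exprn_ge0// ltW. Qed.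

Lemma badness_ge0 w : 0 <= badness w.
Proof.
rewrite /badness !addr_ge0//.
- exact: term1_ge0.
- exact: term2_ge0.
- exact: term3_ge0.
- exact: term4_ge0.
Qed.

Lemma Ex_large i j : Ex P (fun w => large (A w i j)) = H.
Proof. by rewrite (Ex_law (entry_law hA i j) bounded_large) /H abs_tail_Ex. Qed.

Lemma Ex_large_pair i j k : k != j ->
  Ex P (fun w => large (A w i j) * large (A w i k)) = H ^+ 2.
Proof.
move=> kj; have [_ _ iA] := hA.
have us : uniq [:: edge i j; edge i k].
  by rewrite /= andbT mem_seq1; apply: contra kj => /eqP/edge_injr->.
have sD : {subset [:: edge i j; edge i k] <= upper_triangle n.+1}.
  by move=> x; rewrite in_cons mem_seq1 => /orP[]/eqP->; exact: edge_upper.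
have := Ex_prod_indep iA (upper_law hA) (fun=> bounded_large) us sD.
rewrite !big_cons big_nil mulr1 -expr2 /H abs_tail_Ex => <-.
by congr Ex; apply/funext => w; rewrite !big_cons big_nil mulr1 !(entry_edge hA).
Qed.

Lemma Ex_badness : Ex P badness <=
  N ^+ 3 * H ^+ 2 + N * H + s ^- 2 * (N * H) + e ^- K * (N * (M * K.+1%:R) ^+ K).
Proof.
have bl i j : bounded_measurable (fun w => large (A w i j)).
  exact: (bounded_measurable_entry hA _ _ bounded_large).
have b1 : bounded_measurable term1.
  apply: bounded_measurable_sum => i; apply: bounded_measurable_sum => j.
  by apply: bounded_measurable_sum => k; exact: bounded_measurableM.
have b2 : bounded_measurable term2 by exact: bounded_measurable_sum.
have b3' : bounded_measurable (fun w => \sum_i \sum_j v i 0 ^+ 2 * large (A w i j)).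
  apply: bounded_measurable_sum => i.
  by apply: bounded_measurable_sum => j; exact: bounded_measurableZ.
have b3 : bounded_measurable term3 by exact: bounded_measurableZ.
have bg : bounded_measurable (fun x : measurableTypeR R => truncation u x / b).
  under eq_fun do rewrite mulrC.
  exact: bounded_measurableZ (bounded_measurable_truncation u).
have b4' : bounded_measurable (fun w => \tr (small_part w ^+ K)).
  by apply: bounded_measurable_sum => i; exact: (bounded_measurable_pow hA).
have b4 : bounded_measurable term4 by exact: bounded_measurableZ.
have -> : badness = (fun w => term1 w + term2 w + term3 w + term4 w) by [].
rewrite ExD//; last by apply: bounded_measurableD => //; exact: bounded_measurableD.
rewrite ExD//; last exact: bounded_measurableD.
rewrite ExD//; apply: lerD; [apply: lerD; [apply: lerD|]|].
- rewrite Ex_sum => [|i]; last first.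
    apply: bounded_measurable_sum => j; apply: bounded_measurable_sum => k.
    exact: bounded_measurableM.
  apply: le_trans (_ : \sum_(i < n.+1) \sum_(j < n.+1) \sum_(k < n.+1) H ^+ 2 <= _).
    apply: ler_sum => i _; rewrite Ex_sum => [|j]; last first.
      by apply: bounded_measurable_sum => k; exact: bounded_measurableM.
    apply: ler_sum => j _; rewrite Ex_sum => [|k]; last exact: bounded_measurableM.
    rewrite [leRHS](bigID (fun k => k != j)) /= -[leLHS]addr0 lerD//.
      by apply: ler_sum => k kj; rewrite Ex_large_pair.
    by apply: sumr_ge0 => k _; exact: sqr_ge0.
  have sc (c : R) : \sum_(k < n.+1) c = N * c by rewrite sumr_const card_ord -mulr_natl.
  have -> : N ^+ 3 * H ^+ 2 = N * (N * (N * H ^+ 2)) by rewrite !exprS; ring.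
  rewrite -sc; apply: ler_sum => i _; rewrite -sc; apply: ler_sum => j _.
  by rewrite sc.
- rewrite Ex_sum// (eq_bigr (fun=> H)) => [|i _]; last exact: Ex_large.
  by rewrite sumr_const card_ord -mulr_natl.
- rewrite ExZ// ler_wpM2l ?invr_ge0 ?sqr_ge0//.
  rewrite Ex_sum => [|i]; last by apply: bounded_measurable_sum => j; exact: bounded_measurableZ.
  (* The entries being identically distributed, the fixed weights [v i 0 ^+ 2] sum to 1: the bound
     does not depend on how [v] is spread. *)
  rewrite (eq_bigr (fun i => N * H * v i 0 ^+ 2)) => [|i _].
    by rewrite -mulr_sumr -/(sqnorm v) v1 mulr1.
  rewrite Ex_sum => [|j]; last exact: bounded_measurableZ.
  rewrite (eq_bigr (fun=> v i 0 ^+ 2 * H)) => [|j _]; last by rewrite ExZ// Ex_large.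
  by rewrite sumr_const card_ord -mulr_natl -/N; ring.
rewrite ExZ// ler_wpM2l ?invr_ge0 ?exprn_ge0 ?(ltW e0)//.
(* The second moment of a scaled entry in units of [M ^+ 2]; the hypothesis [var] becomes
   [n.+1%:R * rho <= 1]. *)
pose rho := truncated_variance mu u / b ^+ 2 / M ^+ 2.
have V0 : 0 <= truncated_variance mu u by apply: Ex_ge0 => x; exact: sqr_ge0.
have bb : 0 < b ^+ 2 by rewrite exprn_gt0.
have MM : 0 < M ^+ 2 by rewrite exprn_gt0.
apply: (trace_moment hA (rho := rho)) => //.
- move=> x; rewrite normrM (ger0_norm (_ : 0 <= b^-1)) ?invr_ge0 ?(ltW b0)//.
  rewrite ler_pdivrMr//; apply: le_trans uMb; apply: truncation_norm_le; exact: ltW.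
- under [fun x => _]eq_fun do rewrite mulrC.
  rewrite ExZ ?(truncation_centered u smu) ?mulr0//; exact: bounded_measurable_truncation.
- under [fun x => _]eq_fun do rewrite exprMn mulrC.
  rewrite ExZ; last exact: bounded_measurableX (bounded_measurable_truncation u).
  rewrite -/(truncated_variance mu u) /rho mulrC exprVn [leRHS]mulrC divfK//.
  by rewrite gt_eqF.
- by rewrite /rho !divr_ge0// ltW.
- by rewrite /rho mulrA ler_pdivrMr// mul1r mulrA ler_pdivrMr.
Qed.

Section GoodEvent.
Variable w : T.
Hypothesis good : badness w < 1.

Let t1 : term1 w < 1.
Proof.
have := good; rewrite /badness -/(term1 w) -/(term2 w) -/(term3 w) -/(term4 w).
have := term1_ge0 w; have := term2_ge0 w; have := term3_ge0 w; have := term4_ge0 w.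
lra.
Qed.
Let t2 : term2 w < 1.
Proof.
have := good; rewrite /badness -/(term1 w) -/(term2 w) -/(term3 w) -/(term4 w).
have := term1_ge0 w; have := term2_ge0 w; have := term3_ge0 w; have := term4_ge0 w.
lra.
Qed.
Let t3 : term3 w < 1.
Proof.
have := good; rewrite /badness -/(term1 w) -/(term2 w) -/(term3 w) -/(term4 w).
have := term1_ge0 w; have := term2_ge0 w; have := term3_ge0 w; have := term4_ge0 w.
lra.
Qed.
Let t4 : term4 w < 1.
Proof.
have := good; rewrite /badness -/(term1 w) -/(term2 w) -/(term3 w) -/(term4 w).
have := term1_ge0 w; have := term2_ge0 w; have := term3_ge0 w; have := term4_ge0 w.
lra.
Qed.

Lemma good_row i j k : k != j -> u <= `|A w i j| -> `|A w i k| < u.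
Proof.
move=> kj hj; rewrite ltNge; apply/negP => hk; have := t1.
rewrite ltNge => /negP; apply; rewrite /term1 (bigD1 i)//= (bigD1 j)//= (bigD1 k)//=.
rewrite !large01 hj hk mulr1 -!addrA lerDl !addr_ge0//; repeat (apply: sumr_ge0 => ? _);
  by rewrite mulr_ge0 ?large_ge0// -large01.
Qed.

Lemma good_diag i : `|A w i i| < u.
Proof.
rewrite ltNge; apply/negP => hi; have := t2.
rewrite ltNge => /negP; apply; rewrite /term2 (bigD1 i)//= large01 hi lerDl.
by apply: sumr_ge0.
Qed.

Let I := [pred i | [exists j, u <= `|A w i j|]].

Lemma good_mass : \sum_(i | I i) v i 0 ^+ 2 <= s ^+ 2.
Proof.
have [s0 _] := andP s01; have ss : 0 < s ^+ 2 by rewrite exprn_gt0.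
have := ltW t3; rewrite /term3 mulrC ler_pdivrMr// mul1r; apply: le_trans.
rewrite [leRHS](bigID I) /= -[leLHS]addr0 lerD//.
  apply: ler_sum => i /existsP[j hj]; rewrite (bigD1 j)//= large01 hj mulr1 lerDl.
  by apply: sumr_ge0 => k _; rewrite mulr_ge0// sqr_ge0.
by apply: sumr_ge0 => i _; apply: sumr_ge0 => k _; rewrite mulr_ge0// sqr_ge0.
Qed.

Lemma good_small x : `|bilin (small_part w) x x| <= e * sqnorm x.
Proof.
apply: (@trace_small_bilin _ _ _ kappa); [exact: small_part_sym|exact: ltW|].
have eK : 0 < e ^+ K by rewrite exprn_gt0.
by have := ltW t4; rewrite /term4 mulrC ler_pdivrMr// mul1r.
Qed.

Let large_off i j : ~~ I i -> large_part w i j = 0.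
Proof.
rewrite /= negb_exists => /forallP/(_ j); rewrite -ltNge; exact: large_part_eq0.
Qed.

(** On the good event a row of [large_part] has at most one nonzero entry, off the diagonal, so its
    absolute row sum is a single modulus; an entry below the diagonal is read above it by
    symmetry. *)
Lemma good_lambda1_le c : 0 <= c ->
  (forall i j : 'I_n.+1, (i < j)%N -> `|A w i j| < c * b) ->
  lambda1 (b^-1 *: A w + theta *: (v *m v^T)) <= Num.max theta c + e + 2 * s * theta.
Proof.
move=> c0 hc; have [s0 s1] := andP s01.
rewrite -small_large_sum; apply: (lambda1_perturbed_le (I := I)) => //.
- exact: small_part_sym.
- exact: large_part_sym.
- by rewrite s0 ltW.
- exact: good_small.
- exact: good_mass.
move=> i; have [/existsP[j hj]|Ii] := boolP (I i); last first.
  by rewrite big1// => j _; rewrite large_off ?normr0.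
rewrite (bigD1 j)//= big1 ?addr0 => [|k kj]; last first.
  by rewrite large_part_eq0 ?normr0//; exact: good_row hj.
rewrite large_part_entry// normrM (ger0_norm (_ : 0 <= b^-1)) ?invr_ge0 ?(ltW b0)//.
rewrite ler_pdivrMr//; have [ij|ji|ij] := ltngtP i j.
- exact/ltW/hc.
- by rewrite -(sA w) mxE; exact/ltW/hc.
- by have := good_diag i; rewrite {2}(val_inj ij) ltNge hj.
Qed.

Lemma good_lambda1_ge :
  theta * (1 - s ^+ 2) - e <= lambda1 (b^-1 *: A w + theta *: (v *m v^T)).
Proof.
have [s0 s1] := andP s01.
rewrite -small_large_sum; apply: (lambda1_perturbed_ge (I := I)) => //.
- exact: small_part_sym.
- exact: large_part_sym.
- by rewrite s0 ltW.
- exact: good_small.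
- exact: good_mass.
Qed.

Lemma good_lambda1_entry i j : i != j ->
  `|A w i j| / b - M <= lambda1 (b^-1 *: A w + theta *: (v *m v^T)).
Proof.
move=> ij; have h (x : R) : `|b^-1 * x| = `|x| / b.
  by rewrite normrM (ger0_norm (_ : 0 <= b^-1)) ?invr_ge0 ?(ltW b0)// mulrC.
have := @lambda1_entry_ge _ _ (b^-1 *: A w) v theta M i j.
rewrite mxE h; apply=> //; first by rewrite linearZ /= sA.
move=> k; rewrite mxE h ler_pdivrMr//; apply: le_trans uMb.
exact/ltW/good_diag.
Qed.

End GoodEvent.

End BadEvent.

(** * Entries above the diagonal *)

Definition strict_pairs n : {set 'I_n * 'I_n} :=
  [set p : 'I_n * 'I_n | (p.1 < p.2)%N]%SET.

Lemma card_strict_pairs n : (2 * #|strict_pairs n| + n = n ^ 2)%N.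
Proof.
pose D : {set 'I_n * 'I_n} := [set p : 'I_n * 'I_n | p.1 == p.2]%SET.
pose G : {set 'I_n * 'I_n} := [set p : 'I_n * 'I_n | (p.2 < p.1)%N]%SET.
have cG : #|G| = #|strict_pairs n|.
  rewrite -(card_imset (strict_pairs n) (can_inj (@swap_pairK _ _))).
  apply: eq_card => -[i j]; rewrite inE /=; apply/idP/imsetP => [ij|[[k l]]].
    by exists (j, i); rewrite ?inE.
  by rewrite inE /= => kl [-> ->].
have cD : #|D| = n.
  rewrite -[RHS]card_ord -(card_imset 'I_n (f := fun i => (i, i))); last by move=> i j [].
  apply: eq_card => -[i j]; rewrite inE /=; apply/eqP/imsetP => [->|[k _ [-> ->]]//].
  by exists j.
have tri : #|{: 'I_n * 'I_n}| = (#|strict_pairs n| + #|G| + #|D|)%N.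
  rewrite -cardsT -(cardsID (strict_pairs n) [set: _]%SET) finset.setTI -addnA; congr (_ + _)%N.
  rewrite -(cardsID G); congr (_ + _)%N; apply: eq_card => -[i j];
    by rewrite !inE /= -?(inj_eq val_inj) /=; case: ltngtP.
by move: tri; rewrite card_prod !card_ord cG cD -mulnn => ->; rewrite mul2n -addnn.
Qed.

Section NoExceedance.
Context {R : realType} {d : measure_display} {T : measurableType d}.
Context {P : probability T R} {mu : probability (measurableTypeR R) R} {n : nat}.
Variable A : T -> 'M[R]_n.+1.
Hypothesis hA : iid_symmetric_matrix P A mu.

Definition all_below (c : R) : set T :=
  [set w | forall p, p \in strict_pairs n.+1 -> `|A w p.1 p.2| < c].

Lemma measurable_all_below c : measurable (all_below c).
Proof.
have -> : all_below c = \bigcap_(p in [set p | p \in strict_pairs n.+1])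
    [set w | `|A w p.1 p.2| < c] by [].
apply: fin_bigcap_measurable; first exact: finite_finset.
move=> p _; have [mX _] := entry_law hA p.1 p.2.
have -> : [set w | `|A w p.1 p.2| < c] =
    (fun w => A w p.1 p.2) @^-1` (~` [set y : measurableTypeR R | c <= `|y|]).
  by apply/seteqP; split=> w /=; rewrite ltNge => /negP.
rewrite -[X in measurable X]setTI; apply: mX => //.
by apply: measurableC; exact: measurable_tail.
Qed.

Lemma prob_all_below c :
  fine (P (all_below c)) = (1 - abs_tail mu c) ^+ #|strict_pairs n.+1|.
Proof.
have [_ _ iA] := hA.
pose B := ~` [set y : measurableTypeR R | c <= `|y|].
have mB : measurable B by apply: measurableC; exact: measurable_tail.
have sub : strict_pairs n.+1 \subset upper_triangle n.+1.
  by apply/fintype.subsetP => p; rewrite !inE => /ltnW.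
have := iA _ (fun=> B) sub (fun=> mB).
have -> : [set w | forall p, p \in strict_pairs n.+1 -> B (A w p.1 p.2)] = all_below c.
  apply/seteqP; split=> w /= h p pp; have := h p pp; rewrite /B /= ltNge => /negP//.
move=> ->.
have muB : mu B = (1 - abs_tail mu c)%:E.
  rewrite probability_setC; last exact: measurable_tail.
  by rewrite EFinB /abs_tail fineK// fin_num_measure//; exact: measurable_tail.
rewrite (eq_bigr (fun=> (1 - abs_tail mu c)%:E)) => [|p pp].
  by rewrite -(big_morph _ EFinM erefl) prodr_const.
by have [_ ->//] := upper_law hA (fintype.subsetP sub _ pp); rewrite muB.
Qed.

(** Markov's inequality in disguise: pointwise the indicator of [A1] is at most that of [A2] plus
    [B], as [B >= 1] wherever the implication may fail. *)
Lemma prob_le_bad (B : T -> R) (A1 A2 : set T) :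
  bounded_measurable B -> (forall w, 0 <= B w) -> measurable A1 -> measurable A2 ->
  (forall w, B w < 1 -> A1 w -> A2 w) -> fine (P A1) <= fine (P A2) + Ex P B.
Proof.
move=> bB B0 m1 m2 h.
have i1 := bounded_measurable_indic m1 (R := R).
have i2 := bounded_measurable_indic m2 (R := R).
rewrite -!Ex_indic// -ExD//; apply: le_Ex => // [|w]; first exact: bounded_measurableD.
rewrite !indicE; have [wA1|_] := boolP (w \in A1); last by rewrite addr_ge0.
have [Bw|Bw] := ltP (B w) 1; last by rewrite ler_wpDl.
by rewrite mem_set ?ler_wpDr//; apply: h => //; rewrite inE in wA1.
Qed.

End NoExceedance.

(** * Limits as the size of the matrix grows *)

Section Asymptotics.
Context {R : realType} {mu : probability (measurableTypeR R) R} {alpha : R}.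
Hypotheses (alpha0 : 0 < alpha) (alpha4 : alpha < 4).
Hypothesis rv : regularly_varying alpha mu.

(** The lower bound is [1 + x <= exp x] at [x = h / (1 - h)], where the left side is [(1 - h)^-1];
    the upper one is the same inequality at [- h]. *)
Lemma exp1B_bounds (h : R) m : 0 <= h < 1 ->
  expR (- (m%:R * h / (1 - h))) <= (1 - h) ^+ m <= expR (- (m%:R * h)).
Proof.
move=> /andP[h0 h1].
have h1' : 0 < 1 - h by rewrite subr_gt0.
apply/andP; split.
  have : expR (- (h / (1 - h))) <= 1 - h.
    rewrite expRN -[leRHS]invrK lef_pV2 ?posrE ?expR_gt0 ?invr_gt0//.
    apply: le_trans (expR_ge1Dx _); rewrite le_eqVlt; apply/orP; left; apply/eqP.
    by field; rewrite gt_eqF.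
  move=> hh; have -> : - (m%:R * h / (1 - h)) = m%:R * (- (h / (1 - h))) by ring.
  by rewrite expRM_natl lerXn2r// ?nnegrE ?expR_ge0// ltW.
rewrite -mulrN.
by rewrite expRM_natl lerXn2r// ?nnegrE ?expR_ge0 ?(ltW h1')//; exact: expR_ge1Dx.
Qed.

Lemma no_exceedance_cvg x : 0 < x ->
  (1 - abs_tail mu (x * normalization mu n.+1)) ^+ #|strict_pairs n.+1|
    @[n --> \oo] --> expR (- x `^ (- alpha)).
Proof.
move=> x0; pose h n := abs_tail mu (x * normalization mu n.+1).
pose m n : R := #|strict_pairs n.+1|%:R.
have hN := tail_at_normalization alpha0 rv alpha4 x0.
have N0 : (n.+1%:R^-1 : R) @[n --> \oo] --> 0 by exact: cvg_harmonic.
have h0 : h n @[n --> \oo] --> 0.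
  suff : n.+1%:R ^+ 2 * h n * n.+1%:R^-1 * n.+1%:R^-1 @[n --> \oo] -->
      2 * x `^ (- alpha) * 0 * 0.
    rewrite mulr0; apply: cvg_trans; apply: near_eq_cvg; near=> n => /=; field.
    by rewrite nat1r pnatr_eq0.
  by apply: cvgM => //; exact: cvgM.
have mE n : m n = (n.+1%:R ^+ 2 - n.+1%:R) / 2.
  have := congr1 (fun k => k%:R : R) (card_strict_pairs n.+1).
  by rewrite natrD natrM natrX -/(m n); lra.
have mh : m n * h n @[n --> \oo] --> x `^ (- alpha).
  have -> : x `^ (- alpha) = 2^-1 * ((2 * x `^ (- alpha)) * (1 - 0)) by field.
  suff : 2^-1 * ((n.+1%:R ^+ 2 * h n) * (1 - n.+1%:R^-1)) @[n --> \oo] -->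
      2^-1 * ((2 * x `^ (- alpha)) * (1 - 0)).
    by apply: cvg_trans; apply: near_eq_cvg; near=> n => /=; rewrite mE; field.
  apply: cvgM; first exact: cvg_cst; apply: cvgM; first exact: hN.
  by apply: cvgB => //; exact: cvg_cst.
have mh' : m n * h n / (1 - h n) @[n --> \oo] --> x `^ (- alpha).
  rewrite -[X in _ --> X]mulr1 -[X in _ * X]invr1 -{2}[1]subr0.
  apply: cvgM => //; apply: cvgV; first by rewrite subr0 oner_neq0.
  by apply: cvgB => //; exact: cvg_cst.
have cE (f : nat -> R) l : f n @[n --> \oo] --> l -> expR (f n) @[n --> \oo] --> expR l.
  by move=> fl; apply: continuous_cvg => //; exact: continuous_expR.
apply: (@squeeze_cvgr _ _ _ _ (fun n => expR (- (m n * h n / (1 - h n))))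
  (fun n => expR (- (m n * h n)))).
- near=> n; apply: exp1B_bounds; rewrite abs_tail_ge0 /=.
  by near: n; exact: (cvgr_lt _ h0 _ ltr01).
- by apply: cE; exact: cvgN.
- by apply: cE; exact: cvgN.
Unshelve. all: by end_near. Qed.

Definition frechet_cdf (x : R) : R := expR (- x `^ (- alpha)).

Lemma frechet_cdf_continuous x : 0 < x -> {for x, continuous frechet_cdf}.
Proof.
move=> x0; apply: (continuous_comp (f := fun y => - y `^ (- alpha)) (g := expR)); last first.
  exact: continuous_expR.
apply: continuousN; apply: differentiable_continuous; apply/derivable1_diffP.
by apply: derivable_powR; rewrite in_itv /= x0.
Qed.

Lemma frechet_cdf_near x e : 0 < x -> 0 < e -> exists2 r, 0 < r < x &
  forall y, `|y - x| <= r -> `|frechet_cdf y - frechet_cdf x| <= e.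
Proof.
move=> x0 e0; have := frechet_cdf_continuous x0.
move=> /cvgrPdist_le/(_ _ e0)/nbhs_ballP[r /= r0 hr].
exists (Num.min (r / 2) (x / 2)).
  by rewrite lt_min !divr_gt0//= gt_min; apply/orP; right; lra.
move=> y; rewrite le_min => /andP[h1 h2].
rewrite distrC; apply: hr; rewrite /ball /= distrC; apply: le_lt_trans h1 _; lra.
Qed.

(* [B] is small in mean and at least [1] outside the good event. *)
Lemma good_event (d : nat -> measure_display) (T : forall n, measurableType (d n))
    (P : forall n, probability (T n) R) (A : forall n, T n -> 'M[R]_n.+1)
    (v : forall n, 'cV[R]_n.+1) (theta s e dlt : R) :
  (forall n, iid_symmetric_matrix (P n) (A n) mu) -> symmetric_law mu ->
  (forall n, unit_sphere (v n)) -> 0 <= theta -> 0 < s < 1 -> 0 < e -> 0 < dlt ->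
  \forall n \near \oo, 0 < normalization mu n.+1 /\ exists B : T n -> R,
    [/\ bounded_measurable B, forall w, 0 <= B w & Ex (P n) B <= dlt] /\
    forall w, B w < 1 ->
    let l := lambda1 (perturbed mu theta (v n) (A n w)) in
    [/\ forall c, 0 <= c -> all_below (A n) (c * normalization mu n.+1) w ->
          l <= Num.max theta c + e + 2 * s * theta,
        theta * (1 - s ^+ 2) - e <= l &
        forall i j, i != j -> `|A n w i j| / normalization mu n.+1 - e <= l].
Proof.
move=> hA smu hv theta0 s01 e0 dlt0; have /andP[s0 s1] := s01.
have [kappa scale] := truncation_scale alpha0 rv alpha4.
pose K := (2 ^ kappa.+1)%N.
(* The sum of the coefficients in [Ex_badness] once every small quantity is bounded by [e']. It is
   independent of [e'], which can thus be chosen after it. *)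
pose C := 2 + s ^- 2 + e ^- K * K.+1%:R ^+ K.
have C0 : 0 < C.
  by rewrite /C !addr_gt0// ?mulr_gt0// ?invr_gt0 ?exprn_gt0.
pose e' := Num.min e (dlt / C).
have e'0 : 0 < e' by rewrite lt_min e0 divr_gt0.
near=> n.
have b1 : 1 <= normalization mu n.+1 by near: n; exact: (normalization_large alpha0 rv alpha4).
have b0 : 0 < normalization mu n.+1 by apply: lt_le_trans b1.
have : exists u M : R,
  [/\ 0 < u, 0 < M, M <= e' & u <= M * normalization mu n.+1] /\
  [/\ n.+1%:R * truncated_variance mu u <= M ^+ 2 * normalization mu n.+1 ^+ 2,
      n.+1%:R ^+ 3 * abs_tail mu u ^+ 2 <= e',
      n.+1%:R * abs_tail mu u <= e' &
      n.+1%:R * M ^+ (2 ^ kappa.+1) <= e'].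
  by near: n; exact: scale.
move=> [u [M [[u0 M0 Me uM] [V3 H3 H1 NM]]]].
have v1 : sqnorm (v n) = 1.
  have h := hv n; rewrite /unit_sphere /= in h.
  by rewrite -[LHS]sqr_sqrtr ?sqnorm_ge0// [X in X ^+ 2]h expr1n.
split=> //; exists (badness (A n) (v n) (normalization mu n.+1) u s e kappa).
split; first split.
- exact: bounded_measurable_badness.
- by move=> w; apply: badness_ge0.
- apply: le_trans; first by apply: (Ex_badness (hA n) smu v1 (M := M)).
  have X0 : 0 <= s ^- 2 by rewrite invr_ge0 exprn_ge0// ltW.
  have Y0 : 0 <= e ^- K * K.+1%:R ^+ K by rewrite mulr_ge0 ?invr_ge0 ?exprn_ge0 ?(ltW e0).
  rewrite -/K exprMn (mulrA _ (M ^+ K)) (mulrC (n.+1%:R * M ^+ K)) (mulrA (e ^- K)).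
  apply: le_trans (_ : C * e' <= _); last first.
    by rewrite mulrC -ler_pdivlMr// /e' ge_min lexx orbT.
  have -> : C * e' = e' + e' + s ^- 2 * e' + e ^- K * K.+1%:R ^+ K * e'.
    by rewrite /C !mulrDl mul1r.
  by rewrite !lerD// ler_wpM2l.
move=> w good /=; rewrite /perturbed; split.
- move=> c c0 hc; apply: (good_lambda1_le (hA n) v1 b0 s01 e0 theta0 good) => // i j ij.
  by apply: (hc (i, j)); rewrite inE.
- exact: (good_lambda1_ge (hA n) v1 s01 e0 theta0 good).
- move=> i j ij; have := good_lambda1_entry (hA n) b0 e0 theta0 uM good ij.
  apply: le_trans; rewrite lerB//; apply: le_trans Me _; by rewrite ge_min lexx.
Unshelve. all: by end_near. Qed.

End Asymptotics.

(** * Convergence in distribution *)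

Lemma perturbed_sym (R : realType) (mu : probability (measurableTypeR R) R) n
    (theta : R) (v : 'cV[R]_n) (A : 'M[R]_n) : A^T = A ->
  (perturbed mu theta v A)^T = perturbed mu theta v A.
Proof. by move=> sA; rewrite /perturbed linearD !linearZ /= sA trmx_mul trmxK. Qed.

Lemma measurable_lambda1_perturbed (R : realType) d (T : measurableType d)
    (P : probability T R) (mu : probability (measurableTypeR R) R) n
    (theta : R) (v : 'cV[R]_n.+1) (A : T -> 'M[R]_n.+1) :
  iid_symmetric_matrix P A mu ->
  measurable_fun [set: T] (fun w => lambda1 (perturbed mu theta v (A w))).
Proof.
move=> hA; apply: measurable_lambda1 => [w|i j].
  by apply: perturbed_sym; have [] := hA.
under eq_fun do rewrite /perturbed !mxE.
apply: measurable_funD; last exact: measurable_cst.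
by apply: measurable_funM; [exact: measurable_cst|have [] := entry_law hA i j].
Qed.

Lemma measurable_le_set (R : realType) d (T : measurableType d) (f : T -> R) x :
  measurable_fun [set: T] f -> measurable [set w | f w <= x].
Proof.
move=> mf; have -> : [set w | f w <= x] = f @^-1` `]-oo, x].
  by apply/seteqP; split=> w /=; rewrite in_itv.
by rewrite -[X in measurable X]setTI; apply: mf => //; exact: measurable_itv.
Qed.

Lemma measurable_lt_set (R : realType) d (T : measurableType d) (f : T -> R) x :
  measurable_fun [set: T] f -> measurable [set w | f w < x].
Proof.
move=> mf; have -> : [set w | f w < x] = f @^-1` `]-oo, x[.
  by apply/seteqP; split=> w /=; rewrite in_itv.
by rewrite -[X in measurable X]setTI; apply: mf => //; exact: measurable_itv.
Qed.

(** The law is given through strict inequalities; continuity of [frechet_cdf] squeezes the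
    probability of [E <= x] between its values at [x] and [x + r]. *)
Lemma frechet_le_cdf (R : realType) d (T : measurableType d) (P : probability T R)
    (alpha x : R) (E : T -> R) : 0 < alpha -> 0 < x -> frechet P alpha E ->
  fine (P [set w | E w <= x]) = frechet_cdf (alpha := alpha) x.
Proof.
move=> alpha0 x0 [mE _ hE].
have le_fine (A B : set T) : measurable A -> measurable B -> A `<=` B ->
    fine (P A) <= fine (P B).
  move=> mA mB AB; rewrite fine_le ?fin_num_measure//.
  by apply: le_measure; rewrite ?inE.
have lt_cdf y : 0 < y -> fine (P [set w | E w < y]) = frechet_cdf (alpha := alpha) y.
  by move=> y0; rewrite hE.
apply/eqP; rewrite eq_le; apply/andP; split; last first.
  rewrite -lt_cdf//; apply: le_fine => [||w /=]; last exact: ltW.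
    exact: measurable_lt_set.
  exact: measurable_le_set.
apply/ler_addgt0Pr => e e0.
have [r /andP[r0 rx] hr] := frechet_cdf_near (alpha := alpha) x0 e0.
have xr0 : 0 < x + r by rewrite addr_gt0.
apply: le_trans (_ : frechet_cdf (alpha := alpha) (x + r) <= _).
  rewrite -lt_cdf//; apply: le_fine => [||w /= Ew].
  - exact: measurable_le_set.
  - exact: measurable_lt_set.
  - by apply: le_lt_trans Ew _; rewrite ltrDl.
have := hr (x + r); rewrite addrAC subrr add0r gtr0_norm// => /(_ (lexx _)).
by rewrite ler_norml => /andP[_]; rewrite lerBlDr (addrC e).
Qed.

Lemma sandwich_dist (R : realType) (p F Fm Fp pm pp B dlt : R) :
  `|Fm - F| <= dlt / 3 -> `|Fp - F| <= dlt / 3 ->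
  `|Fm - pm| <= dlt / 3 -> `|Fp - pp| <= dlt / 3 -> B <= dlt / 3 ->
  pm <= p + B -> p <= pp + B -> `|F - p| <= dlt.
Proof.
rewrite !ler_norml => /andP[? ?] /andP[? ?] /andP[? ?] /andP[? ?] ? ? ?.
by apply/andP; split; lra.
Qed.

Theorem theorem1 (R : realType) (alpha : R)
    (halpha : 0 < alpha /\ alpha < 4)
    (mu : probability (measurableTypeR R) R)
    (mu_sym : symmetric_law mu)
    (mu_rv : regularly_varying alpha mu)
    (d : nat -> measure_display) (T : forall n, measurableType (d n))
    (P : forall n, probability (T n) R)
    (A : forall n, T n -> 'M[R]_n.+1)
    (hA : forall n, iid_symmetric_matrix (P n) (A n) mu)
    (theta : R) (htheta : 0 < theta)
    (v : forall n, 'cV[R]_n.+1)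
    (hv : forall n, unit_sphere (v n))
    (dE : measure_display) (TE : measurableType dE) (PE : probability TE R)
    (E : TE -> R) (hE : frechet PE alpha E) :
  cvg_in_distribution P
    (fun n w => lambda1 (perturbed mu theta (v n) (A n w)))
    PE (fun w => Num.max theta (E w)).
Proof.
have [alpha0 alpha4] := halpha.
have [mE E0 cdfE] := hE.
pose X n w := lambda1 (perturbed mu theta (v n) (A n w)).
have mX n : measurable_fun [set: T n] (X n).
  exact: measurable_lambda1_perturbed (hA n).
have mmax : measurable_fun [set: TE] (fun w => Num.max theta (E w)).
  by apply: measurable_maxr => //; exact: measurable_cst.
split=> // x xcont.
have mXx n : measurable [set w | X n w <= x] by exact: measurable_le_set.
have mM y : measurable [set w | Num.max theta (E w) <= y] by exact: measurable_le_set.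
suff : fine (P n [set w | X n w <= x]) @[n --> \oo] -->
    fine (PE [set w | Num.max theta (E w) <= x]).
  move=> h; rewrite -[X in _ --> X]fineK ?fin_num_measure//.
  by apply: cvg_EFin => //; near=> n; rewrite fin_num_measure.
have below y : y < theta -> [set w | Num.max theta (E w) <= y] = set0.
  by move=> yt; apply/seteqP; split=> w //=; rewrite ge_max leNgt yt.
have [xt|tx|xt] := ltgtP x theta.
- rewrite (below x xt) measure0 /=; apply/cvgrPdist_le => dlt dlt0.
  (* On the good event [lambda1] is at least [theta - 2 * e], which exceeds [x = theta - 4 * e]; so
     [lambda1 <= x] happens only on the bad event. *)
  pose e := (theta - x) / 4; have e0 : 0 < e by rewrite divr_gt0 ?subr_gt0.
  pose s := Num.min 2^-1 (e / theta).
  have s0 : 0 < s by rewrite lt_min invr_gt0 ltr0n divr_gt0.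
  have s2 : s <= 2^-1 by rewrite ge_min lexx.
  have se : theta * s <= e.
    by rewrite mulrC -ler_pdivlMr// ge_min lexx orbT.
  have s1 : s < 1 by apply: le_lt_trans s2 _; rewrite invf_lt1 ?ltr1n.
  have s01 : 0 < s < 1 by rewrite s0.
  have := good_event alpha0 alpha4 mu_rv hA mu_sym hv (ltW htheta) s01 e0 dlt0.
  apply: filterS => n [b0 [B [[bB B0 EB] hB]]].
  rewrite sub0r normrN ger0_norm; last by rewrite fine_ge0.
  apply: le_trans EB.
  have := @prob_le_bad _ _ _ (P n) B [set w | X n w <= x] set0 bB B0 (mXx n) measurable0.
  rewrite measure0 add0r; apply=> w Bw /= Xx.
  have [_ + _] := hB w Bw; rewrite -/(X n w) => h.
  have ss : theta * s ^+ 2 <= e.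
    by apply: le_trans se; rewrite ler_wpM2l ?(ltW htheta)// expr2 ler_piMl// ltW.
  suff : theta <= x + 2 * e by rewrite /e; lra.
  rewrite mulrBr mulr1 in h; lra.
- have x0 : 0 < x by apply: lt_trans tx.
  have -> : [set w | Num.max theta (E w) <= x] = [set w | E w <= x].
    by apply/seteqP; split=> w /=; rewrite ge_max (ltW tx).
  rewrite (frechet_le_cdf alpha0 x0 hE); apply/cvgrPdist_le => dlt dlt0.
  have dlt3 : 0 < dlt / 3 by rewrite divr_gt0.
  have [r /andP[r0 rx] hr] := frechet_cdf_near (alpha := alpha) x0 dlt3.
  (* The bound [r] keeps [x - f] and [x + f] where the limit varies little, and [x - theta] ensures
     [theta <= x - f]. With [e = f / 2] and [2 * s * theta <= e], the error on [lambda1] is at most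
     [f]. *)
  pose f := Num.min r (x - theta).
  have f0 : 0 < f by rewrite lt_min r0 subr_gt0.
  have fr : f <= r by rewrite ge_min lexx.
  have ft : f <= x - theta by rewrite ge_min lexx orbT.
  pose e := f / 2; have e0 : 0 < e by rewrite divr_gt0.
  have ef : e < f by rewrite ltr_pdivrMr// ltr_pMr// ltr1n.
  have tf : theta <= x - f by rewrite lerBrDr addrC -lerBrDr.
  pose s := Num.min 2^-1 (e / (2 * theta)).
  have s0 : 0 < s by rewrite lt_min invr_gt0 ltr0n divr_gt0 ?mulr_gt0.
  have s2 : s <= 2^-1 by rewrite ge_min lexx.
  have se : 2 * s * theta <= e.
    rewrite mulrAC mulrC -ler_pdivlMr ?mulr_gt0//.
    by rewrite ge_min lexx orbT.
  have s1 : s < 1 by apply: le_lt_trans s2 _; rewrite invf_lt1 ?ltr1n.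
  have s01 : 0 < s < 1 by rewrite s0.
  have good := good_event alpha0 alpha4 mu_rv hA mu_sym hv (ltW htheta) s01 e0 dlt3.
  have xm0 : 0 < x - f by apply: lt_le_trans htheta _; lra.
  have xp0 : 0 < x + f by rewrite addr_gt0.
  have lim y : 0 < y -> fine (P n (all_below (A n) (y * normalization mu n.+1)))
      @[n --> \oo] --> frechet_cdf (alpha := alpha) y.
    move=> y0; under eq_fun do rewrite (prob_all_below (hA _)).
    exact: no_exceedance_cvg.
  have /cvgrPdist_le/(_ _ dlt3) limm := lim _ xm0.
  have /cvgrPdist_le/(_ _ dlt3) limp := lim _ xp0.
  have hm := hr (x - f); have hp := hr (x + f).
  have am : `|x - f - x| <= r by rewrite addrAC subrr add0r normrN gtr0_norm.
  have ap : `|x + f - x| <= r by rewrite addrAC subrr add0r gtr0_norm.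
  move: (hm am) (hp ap) => {}hm {}hp.
  apply: filterS3 good limm limp => n [b0 [B [[bB B0 EB] hB]]] lm lp.
  have up : fine (P n (all_below (A n) ((x - f) * normalization mu n.+1))) <=
      fine (P n [set w | X n w <= x]) + Ex (P n) B.
    apply: prob_le_bad => // [|w Bw below_w /=]; first exact: measurable_all_below (hA n) _.
    have [h _ _] := hB w Bw; apply: le_trans (h _ (ltW xm0) below_w) _.
    have -> : Num.max theta (x - f) = x - f by exact/max_idPr.
    apply: le_trans (lerD (lexx _) se) _.
    by rewrite -addrA -splitr subrK.
  (* Conversely [lambda1 <= x] keeps every modulus off the diagonal at most [(x + e) b], hence
     strictly below [(x + f) b]. *)
  have lo : fine (P n [set w | X n w <= x]) <=
      fine (P n (all_below (A n) ((x + f) * normalization mu n.+1))) + Ex (P n) B.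
    apply: prob_le_bad => // [|w Bw /= Xx p]; first exact: measurable_all_below (hA n) _.
    rewrite inE => pp; have pne : p.1 != p.2 by apply: contraTneq pp => ->; rewrite ltnn.
    have [_ _ h] := hB w Bw; have := h _ _ pne; rewrite -/(X n w) => h'.
    rewrite -ltr_pdivrMr//; have := le_trans h' Xx.
    by rewrite lerBlDr => /le_lt_trans; apply; rewrite ltrD2l.
  exact: sandwich_dist hm hp lm lp EB up lo.
(* The point [theta] is no continuity point: the limiting distribution function is 0 to its left and
   [exp(- theta^(-alpha)) > 0] at it. *)
- exfalso.
  have pos : 0 < fine (PE [set w | Num.max theta (E w) <= theta]).
    have -> : [set w | Num.max theta (E w) <= theta] = [set w | E w <= theta].
      by apply/seteqP; split=> w /=; rewrite ge_max lexx.
    by rewrite (frechet_le_cdf alpha0 htheta hE) expR_gt0.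
  move: xcont; rewrite xt => /= hc.
  have : fine (PE [set w | Num.max theta (E w) <= t]) @[t --> theta] -->
      fine (PE [set w | Num.max theta (E w) <= theta]).
    have : PE [set w | Num.max theta (E w) <= t] @[t --> theta] -->
        (fine (PE [set w | Num.max theta (E w) <= theta]))%:E.
      by rewrite fineK ?fin_num_measure.
    by move=> /fine_cvgP[].
  move=> /cvgr_gt/(_ _ pos)/nbhs_ballP[r /= r0 hr].
  have : 0 < fine (PE [set w | Num.max theta (E w) <= theta - r / 2]).
    apply: hr; rewrite /ball /= opprB addrC subrK gtr0_norm; lra.
  by rewrite below ?measure0 ?ltxx//; lra.
Unshelve. all: by end_near. Qed.
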